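(* Let $m\ge 1$ and let $K$ and $V$ be convex bodies in $\mathbb{R}^m$ that are centrally symmetric with respect to the origin. Let $\mathbf{a}\in\partial(V)$ be any point with $\|\mathbf{a}\|_K=M(K,V)$. (a) For every $f\in B_V\cap C(\mathbb{R}^m)$ and $x\in\mathbb{R}^m$, $$\|\nabla f(x)\|_K\le M(K,V)\,\|f\|_{C(\mathbb{R}^m)}.$$ For every function $f_0(x):=C_1e^{i(\mathbf{a},x)}+C_2e^{-i(\mathbf{a},x)}$ with $C_1,C_2\in\mathbb{C}$, there exists $x_0\in\mathbb{R}^m$ such that $\|\nabla f_0(x_0)\|_K=M(K,V)\,\|f_0\|_{C(\mathbb{R}^m)}$. Hence the inequality $\|\nabla f(x)\|_K\le M(K,V)\,\|f\|_{C(\mathbb{R}^m)}$ is sharp. (b) For every $f\in B_V\cap C(\mathbb{R}^m)$ that is real-valued on $\mathbb{R}^m$ and every $x\in\mathbb{R}^m$, $$\|\nabla f(x)\|_K^2+M^2(K,V)\,f^2(x)\le M^2(K,V)\,\|f\|_{C(\mathbb{R}^m)}^2.$$ There exists $x_0\in\mathbb{R}^m$ such that for all functions $f_0(x):=R_1\cos(\mathbf{a},x)+R_2\sin(\mathbf{a},x)$ with $R_1,R_2\in\mathbb{R}$, for which $\|f_0\|_{C(\mathbb{R}^m)}=(R_1^2+R_2^2)^{1/2}$, the equality $\|\nabla f_0(x_0)\|_K^2+M^2(K,V)\,f_0^2(x_0)=M^2(K,V)\,\|f_0\|_{C(\mathbb{R}^m)}^2$ holds. Hence the inequality $\|\nabla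 f(x)\|_K^2+M^2(K,V)\,f^2(x)\le M^2(K,V)\,\|f\|_{C(\mathbb{R}^m)}^2$ is sharp.
   Context: $(t,y)=\sum_{j=1}^m t_jy_j$; $\nabla f(x)=(\partial f(x)/\partial x_1,\ldots,\partial f(x)/\partial x_m)$. A convex body is a compact convex set with non-empty interior; $\partial(V)$ is the boundary of $V$. For an origin-symmetric convex body $V$, its polar is $V^*=\{y\in\mathbb{R}^m: |(t,y)|\le 1 \text{ for all } t\in V\}$ (and $V^{**}=V$). Norms: $\|x\|_V:=\max_{t\in V^*}|(t,x)|$ on $\mathbb{R}^m$ (unit ball $V$); for complex vectors $z\in\mathbb{C}^m$, $\|z\|_{V^*}:=\max_{t\in V}|\sum_{j=1}^m t_jz_j|$ and, correspondingly, $\|z\|_K:=\max_{t\in K^*}|\sum_{j=1}^m t_jz_j|$. Define $M(K,V):=\max_{y\in V}\|y\|_K=\max_{y\in\partial(V)}\|y\|_K$. $C(\mathbb{R}^m)$ is the space of continuous complex-valued functions $F$ on $\mathbb{R}^m$ with finite norm $\|F\|_{C(\mathbb{R}^m)}=\sup_{x\in\mathbb{R}^m}|F(x)|$. $B_V$ is the set of entire functions $f:\mathbb{C}^m\to\mathbb{C}$ of exponential type $V$, i.e. such that for every $\varepsilon>0$ there is a constant $C_0(\varepsilon,f)>0$ with $|f(z)|\le C_0(\varepsilon,f)\exp[(1+\varepsilon)\|z\|_{V^*}]$ for all $z\in\mathbb{C}^m$. The same notation is used for $f\in B_V$ and its restriction to $\mathbb{R}^m$. *)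

(* Defs.v *)
From HB Require Import structures.
From mathcomp Require Import all_boot all_order all_algebra.
From mathcomp Require Import complex.
From mathcomp Require Import all_classical all_reals all_analysis.

Set Implicit Arguments.
Unset Strict Implicit.
Unset Printing Implicit Defensive.

Import Order.TTheory GRing.Theory Num.Theory.
Import numFieldNormedType.Exports.

Local Open Scope classical_set_scope.
Local Open Scope ring_scope.
Local Open Scope complex_scope.

(* Holomorphy on all of C^m: Frechet differentiability over the field C itself
   (C^o is C as a normed space over itself). It is used with C := R[i]; the
   abstract C lets the normed structures of 'rV[C]_m and C^o be inferred. *)
Definition entire (C : numFieldType) (m : nat) (F : 'rV[C]_m -> C) : Prop :=
  forall z, differentiable (F : 'rV[C]_m -> C^o) z.

Section Defs.
Variables (R : realType) (m : nat).
Implicit Types (t x y a : 'rV[R]_m) (z : 'rV[R[i]]_m) (A K V : set 'rV[R]_m).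

Definition toC x : 'rV[R[i]]_m := map_mx (fun r : R => r%:C) x.

Definition dot t y : R := \sum_j t 0 j * y 0 j.

Definition dotC t z : R[i] := \sum_j (t 0 j)%:C * z 0 j.

Definition boundary A : set 'rV[R]_m := closure A `\` interior A.

Definition convex_body V : Prop :=
  [/\ compact V, convex_set V & interior V !=set0].

Definition origin_symmetric V : Prop := forall x, V x -> V (- x).

Definition polar V : set 'rV[R]_m := [set y | forall t, V t -> `|dot t y| <= 1].

(* In the next four definitions the suprema are maxima of continuous functions
   over compact sets whenever K and V are origin-symmetric convex bodies. *)

(* ||x||_K for real vectors, the norm with unit ball K *)
Definition body_norm K x : R := sup [set `|dot t x| | t in polar K].

(* ||z||_{V^*} for complex vectors: the maximum is over V = V^** *)
Definition polar_normC V z : R := sup [set Normc.normc (dotC t z) | t in V].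

(* ||z||_K for complex vectors *)
Definition body_normC K z : R := sup [set Normc.normc (dotC t z) | t in polar K].

Definition MKV K V : R := sup [set body_norm K y | y in V].

Definition BV (V : set 'rV[R]_m) (F : 'rV[R[i]]_m -> R[i]) : Prop :=
  entire F /\
  forall e : R, 0 < e -> exists C0 : R, 0 < C0 /\
    forall z, Normc.normc (F z) <= C0 * expR ((1 + e) * polar_normC V z).

Definition sup_norm (f : 'rV[R]_m -> R[i]) : R := sup (range (fun x => Normc.normc (f x))).

Definition bounded_continuous (f : 'rV[R]_m -> R[i]) : Prop :=
  continuous (f : 'rV[R]_m -> R[i]^o) /\
  exists b : R, forall x, Normc.normc (f x) <= b.

(* B_V \cap C(R^m): the functions on R^m that are bounded, continuous and the
   restriction of a member of B_V. *)
Definition BC V (f : 'rV[R]_m -> R[i]) : Prop :=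
  (exists2 F, BV V F & forall x, f x = F (toC x)) /\ bounded_continuous f.

Definition real_valued (f : 'rV[R]_m -> R[i]) : Prop :=
  forall x, complex.Im (f x) = 0.

(* The partial derivatives of a complex-valued function of real variables are
   taken separately on its real and imaginary parts. *)
Definition grad (f : 'rV[R]_m -> R[i]) x : 'rV[R[i]]_m :=
  \row_j ('D_(delta_mx 0 j) (fun u => complex.Re (f u)) x
          +i* 'D_(delta_mx 0 j) (fun u => complex.Im (f u)) x).

(* e^{i s} for real s *)
Definition expi (s : R) : R[i] := cos s +i* sin s.

End Defs.

(* Main.v *)
Require Import Defs.
From HB Require Import structures.
From mathcomp Require Import all_boot all_order all_algebra.
From mathcomp Require Import complex.
From mathcomp Require Import all_classical all_reals all_analysis.
From mathcomp Require Import ring lra.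

Set Implicit Arguments.
Unset Strict Implicit.
Unset Printing Implicit Defensive.

Import Order.TTheory GRing.Theory Num.Theory.
Import numFieldNormedType.Exports.
Import Normc.

Local Open Scope classical_set_scope.
Local Open Scope ring_scope.
Local Open Scope complex_scope.

(** The norm of the gradient is a supremum of derivatives along single lines:
    for t in the polar of K, the number (t, grad f(x)) is the derivative at 0 of
    the function h(w) = f(x + w t) of one complex variable.  On that line the
    norm that measures the type of f grows at most like M(K,V) |w|, because
    |(t, v)| <= ||v||_K <= M(K,V) for v in V ([polar_normC_line]).  So h is entire
    of exponential type at most M(K,V) and bounded on the real axis by the norm
    of f.  The two inequalities are thus the one-variable inequalities of
    Bernstein, |h'| <= s ||h||, and of Bernstein and Szego,
    h'^2 + s^2 h^2 <= s^2 ||h||^2 for real h, where s is the type.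

    The first follows from the second: rotate h so that h'(x) >= 0 and replace it
    by the holomorphic function that equals its real part on the axis
    ([bernstein]).

    For the second, let |h| <= 1 on the axis.  The Phragmen-Lindelof principle
    gives |h(x + iy)| <= exp(s y) for y >= 0.  It applies as well to the iterates
    of h under T(z) = 2 z^2 - 1: T maps [-1, 1] to itself and doubles the type, so
    the k-th iterate is at most exp(2^k s y).  If h(x + iy) = (w + 1/w) / 2 with
    |w| >= 1, that iterate is (w^N + w^-N) / 2 with N = 2^k; letting k grow forces
    |w| <= exp(s y), that is, h(x + iy) lies inside the ellipse with foci -1 and 1
    and semi-axes cosh(s y) and sinh(s y) ([ellipse_bound]).  As y tends to 0, the
    equation of the ellipse turns into h(x)^2 + h'(x)^2 / s^2 <= 1
    ([bernstein_szego_unit]).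

    The Phragmen-Lindelof principle is obtained from the maximum principle on
    compact sets by comparing with exponentials of quadratic polynomials, whose
    real parts supply all the harmonic majorants needed.  The maximum principle
    itself rests on the mean value property along circles, that is, on Goursat's
    theorem applied to h(z + exp w) on the rectangle [log d, log r] x [0, 2 pi],
    whose horizontal sides cancel by periodicity.

    Equality and sharpness are read off from the exponentials exp(+-i (a, x)): on
    them the gradient is a scalar multiple of a, and since a <> 0 the phase
    (a, x) takes every real value. *)

Local Notation Re := complex.Re.
Local Notation Im := complex.Im.

(** * Moduli of complex numbers and the complex exponential *)

Section ComplexModulus.
Variable R : realType.
Implicit Types z w : R[i].

Lemma normr_normc z : `|z| = (normc z)%:C. Proof. by []. Qed.

Lemma normc_ge0 z : 0 <= normc z.
Proof. by case: z => a b; exact: sqrtr_ge0. Qed.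

Lemma normc_sqr z : normc z ^+ 2 = Re z ^+ 2 + Im z ^+ 2.
Proof. by case: z => a b; rewrite /= sqr_sqrtr // addr_ge0 // sqr_ge0. Qed.

Lemma Re_le_normc z : `|Re z| <= normc z.
Proof.
rewrite -(@ler_pXn2r _ 2) ?nnegrE ?normc_ge0 //.
by rewrite normc_sqr real_normK ?num_real // lerDl sqr_ge0.
Qed.

Lemma Im_le_normc z : `|Im z| <= normc z.
Proof.
rewrite -(@ler_pXn2r _ 2) ?nnegrE ?normc_ge0 //.
by rewrite normc_sqr real_normK ?num_real // lerDr sqr_ge0.
Qed.

Lemma normc_real (x : R) : normc x%:C = `|x|.
Proof. by rewrite /= expr0n /= addr0 sqrtr_sqr. Qed.

Lemma normc_imag (x : R) : normc (0 +i* x) = `|x|.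
Proof. by rewrite /= expr0n /= add0r sqrtr_sqr. Qed.

Lemma normc_le_ReIm z : normc z <= `|Re z| + `|Im z|.
Proof.
case: z => a b; rewrite [in leLHS](_ : a +i* b = a%:C + (0 +i* b)); last first.
  by apply/eqP; rewrite eq_complex /= addr0 add0r !eqxx.
by apply: (le_trans (le_normcD _ _)); rewrite normc_real normc_imag.
Qed.

Lemma normcX z n : normc (z ^+ n) = normc z ^+ n.
Proof. by elim: n => [|n IH]; rewrite ?expr0 ?normc1 // !exprS normcM IH. Qed.

Lemma normc_gt0 z : (0 < normc z) = (z != 0).
Proof.
rewrite lt_neqAle normc_ge0 andbT eq_sym; congr (~~ _).
by apply/eqP/eqP => [/eq0_normc //|->]; exact: normc0.
Qed.

Lemma normc_conj z : normc (conjc z) = normc z.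
Proof. by case: z => a b /=; rewrite sqrrN. Qed.

Lemma phaseP z : exists2 c : R[i], normc c = 1 & c * z = (normc z)%:C.
Proof.
have [->|z0] := eqVneq z 0.
  by exists 1; [exact: normc1 | rewrite mulr0 (@normc0 R)].
exists ((normc z)%:C * z^-1).
  rewrite normcM normcV normc_real ger0_norm ?normc_ge0// divff//.
  by rewrite gt_eqF// normc_gt0.
by rewrite -mulrA mulVf// mulr1.
Qed.

Definition cexp z : R[i] := (expR (Re z) * cos (Im z)) +i* (expR (Re z) * sin (Im z)).

Lemma cexpD z w : cexp (z + w) = cexp z * cexp w.
Proof.
case: z w => [a b] [c d]; rewrite /cexp /= expRD cosD sinD.
by congr (_ +i* _); ring.
Qed.

Lemma cexp0 : cexp 0 = 1.
Proof. by rewrite /cexp /= expR0 cos0 sin0 !mul1r. Qed.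

Lemma normc_cexp z : normc (cexp z) = expR (Re z).
Proof.
apply/eqP; rewrite -(@eqrXn2 _ 2) ?normc_ge0 ?expR_ge0//; apply/eqP.
rewrite normc_sqr /= !exprMn -mulrDr cos2Dsin2 mulr1 //.
Qed.

End ComplexModulus.

(** * Complex derivatives *)

Section ComplexDerivative.
Variable R : realType.
Local Notation C := R[i].
Implicit Types (h : C -> C) (z w l : C).

Definition holo h := forall z : C^o, differentiable (h : C^o -> C^o) z.

Definition cderiv_at h z l := forall e : R, 0 < e ->
  exists2 d : R, 0 < d &
    forall w, normc w <= d -> normc (h (z + w) - h z - l * w) <= e * normc w.

(** Unfolds a complex limit of difference quotients into a bound between real
    numbers, so that all later estimates take place in the real field. *)
Lemma cvg_slopeP (g : C -> C) l : g 0 = 0 ->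
  ((fun w : C => w^-1 * g w : C^o) @ (0 : C^o)^' --> (l : C^o)) <->
  (forall e : R, 0 < e -> exists2 d : R, 0 < d &
     forall w, normc w <= d -> normc (g w - l * w) <= e * normc w).
Proof.
move=> g0.
have E w : w != 0 -> normc (g w - l * w) = normc (l - w^-1 * g w) * normc w.
  move=> w0; rewrite -normcM -normcN; congr normc.
  by rewrite mulrBl mulrAC mulVf// mul1r opprB.
split=> [/cvgrPdist_le /= H e e0|H].
  have /H : 0 < e%:C by rewrite ltcR.
  rewrite near_withinE => /nbhs_ballP [/= d0 d00 dP].
  have d0E : d0 = (Re d0)%:C by rewrite RRe_real // gtr0_real.
  move: d00 dP; rewrite d0E ltcR; set d := Re d0 => d0_gt0 dP.
  exists (d / 2); first by rewrite divr_gt0.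
  move=> w wd; have [->|w0] := eqVneq w 0.
    by rewrite g0 mulr0 subrr (@normc0 R) mulr0.
  have /dP : ball (0 : C^o) d%:C w.
    rewrite -ball_normE /= sub0r normrN normr_normc ltcR (le_lt_trans wd)//.
    by rewrite ltr_pdivrMr// ltr_pMr// ltr1n.
  by move=> /(_ w0); rewrite normr_normc lecR E// => Hw; rewrite ler_wpM2r ?normc_ge0.
apply/cvgrPdist_le => /= e e0.
have eE : e = (Re e)%:C by rewrite RRe_real // gtr0_real.
move: e0; rewrite eE ltcR => /H [d d0 dP].
rewrite near_withinE; apply/nbhs_ballP; exists d%:C; first by rewrite /= ltcR.
move=> w /=; rewrite -ball_normE /= sub0r normrN normr_normc ltcR => wd w0.
by rewrite normr_normc lecR; have := dP w (ltW wd); rewrite E// ler_pM2r// normc_gt0.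
Qed.

Lemma cderiv_atP h z :
  differentiable (h : C^o -> C^o) (z : C^o) <-> exists l, cderiv_at h z l.
Proof.
rewrite -(@derivable1_diffP C C^o h z).
pose g w := h (z + w) - h z; have g0 : g 0 = 0 by rewrite /g addr0 subrr.
have E : (fun w : C => w^-1 *: ((h : C^o -> C^o) (w *: (1 : C^o) + z) - h z : C^o))
    = (fun w => w^-1 * g w).
  by apply/funext => w; rewrite /g /GRing.scale /= mulr1 (addrC w).
split=> [/cvg_ex[/= l]|[l H]].
  by rewrite E => /(cvg_slopeP _ g0) H; exists l.
by apply/cvg_ex; exists l; rewrite /= E; exact/(cvg_slopeP _ g0).
Qed.

Lemma holo_cderiv h z : holo h -> exists l, cderiv_at h z l.
Proof. by move=> /(_ z)/cderiv_atP. Qed.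

Lemma cderiv_holo h : (forall z, exists l, cderiv_at h z l) -> holo h.
Proof. by move=> H z; apply/cderiv_atP. Qed.

Lemma holo_cst l : holo (fun=> l).
Proof. by move=> z; exact: differentiable_cst. Qed.

Lemma holo_id : holo id.
Proof. by move=> z; apply: ex_diff. Qed.

Lemma holoD h k : holo h -> holo k -> holo (fun z => h z + k z).
Proof. by move=> hh hk z; exact: (differentiableD (hh z) (hk z)). Qed.

Lemma holoM h k : holo h -> holo k -> holo (fun z => h z * k z).
Proof. by move=> hh hk z; exact: (@differentiableM C C^o h k z (hh z) (hk z)). Qed.

Lemma holo_comp h k : holo h -> holo k -> holo (fun z => k (h z)).
Proof. by move=> hh hk z; exact: (differentiable_comp (hh z) (hk _)). Qed.

(* Bounds near 0 from which the derivative of exp(x + iy) at the origin follows. *)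
Lemma expR_mul1B_le1 (x : R) : expR x * (1 - x) <= 1.
Proof.
apply: (le_trans _ (_ : expR x * expR (- x) <= 1)); last by rewrite expRxMexpNx_1.
by rewrite ler_pM2l ?expR_gt0// expR_ge1Dx.
Qed.

Lemma expR_sub1_bound (x : R) : `|x| <= 1/2 -> `|expR x - 1| <= 2 * `|x|.
Proof.
have H1 := expR_ge1Dx x; have H2 := expR_mul1B_le1 x.
move: (expR x) H1 H2 => e H1 H2.
rewrite !ler_norml => /andP[xa xb].
case: (leP 0 x) => x0; [rewrite (ger0_norm x0) | rewrite (ltr0_norm x0)]; apply/andP; split; nra.
Qed.

Lemma expR_taylor1_bound (x : R) : `|x| <= 1/2 -> `|expR x - 1 - x| <= 2 * x ^+ 2.
Proof.
have H1 := expR_ge1Dx x; have H2 := expR_mul1B_le1 x.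
move: (expR x) H1 H2 => e H1 H2.
rewrite !ler_norml expr2 => /andP[xa xb]; apply/andP; split; nra.
Qed.

Lemma sin_lipschitz (x : R) : `|sin x| <= `|x|.
Proof.
wlog x0 : x / 0 < x.
  move=> H; have [x0|x0|->] := ltgtP x 0; [|exact: H|by rewrite sin0].
  by rewrite -normrN -sinN -(normrN x) H// oppr_gt0.
have [c _] := @MVT R sin cos 0 x x0 (fun y _ => is_derive_sin y)
  (continuous_subspaceT (@continuous_sin R)).
by rewrite sin0 !subr0 => ->; rewrite normrM ler_piMl// cos_max.
Qed.

Lemma cos_sub1_bound (x : R) : `|cos x - 1| <= x ^+ 2.
Proof.
have -> : x = (x / 2) *+ 2 by rewrite mulr2n -splitr.
have := sin_lipschitz (x / 2); set y := x / 2.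
rewrite cos_mulr2n cos2sin2 -(@ler_pXn2r _ 2) ?nnegrE// !real_normK ?num_real// => H.
have := sqr_ge0 y; have := sqr_ge0 (sin y); rewrite ler_norml; rewrite !mulr2n; nra.
Qed.

Lemma sin_taylor1_bound (x : R) : `|sin x - x| <= x ^+ 2 * `|x|.
Proof.
wlog x0 : x / 0 < x.
  move=> H; have [x0|x0|->] := ltgtP x 0; [|exact: H|by rewrite sin0 subr0 normr0 mulr0].
  by rewrite -normrN opprB -(normrN x) -(sqrrN x) (_ : x - sin x = sin (- x) - - x) ?H ?oppr_gt0// sinN opprK addrC.
have D y : y \in `]0, x[ -> is_derive y 1 (fun t : R => sin t - t) (cos y - 1).
  by move=> _; apply: is_deriveB.
have cN : {within `[0, x], continuous (fun t : R => sin t - t)}.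
  apply: continuous_subspaceT => y; apply: cvgB; [exact: continuous_sin|exact: cvg_id].
have [c] := MVT x0 D cN.
rewrite in_itv /= => /andP[c0 cx]; rewrite sin0 !subr0 => ->.
rewrite normrM ler_wpM2r// (le_trans (cos_sub1_bound c))//.
by rewrite ler_pXn2r ?nnegrE// ltW.
Qed.

Lemma cderiv_cexp0 : cderiv_at (@cexp R) 0 1.
Proof.
move=> e e0; exists (Num.min (1/2) (e / 10)); first by rewrite lt_min !divr_gt0//.
move=> [x y]; rewrite le_min => /andP[].
rewrite add0r cexp0 (mul1r (x +i* y)) => w1 w2.
apply: (le_trans (normc_le_ReIm _)).
have := normc_ge0 (x +i* y); have := Re_le_normc (x +i* y).
have := Im_le_normc (x +i* y); move: w1 w2.
move: (normc (x +i* y)) => n /= w1 w2 wy wx n0.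
have xh : `|x| <= 1/2 by exact: le_trans wx w1.
have E1 := expR_sub1_bound xh; have E2 := expR_taylor1_bound xh.
have C1 := cos_sub1_bound y; have S1 := sin_lipschitz y.
have S2 := sin_taylor1_bound y.
have x2 : x ^+ 2 <= n * n.
  by rewrite -real_normK ?num_real// expr2 ler_pM.
have y2 : y ^+ 2 <= n * n.
  by rewrite -[leLHS]real_normK ?num_real// expr2 ler_pM.
have ex2 : `|expR x| <= 2.
  rewrite -[expR x](subrK 1) (le_trans (ler_normD _ _))// normr1; lra.
have -> : expR x * cos y - 1 - x = (expR x - 1 - x) + expR x * (cos y - 1) by ring.
have -> : expR x * sin y - 0 - y = (expR x - 1) * sin y + (sin y - y) by ring.
apply: (@le_trans _ _ ((2 * (n * n) + 2 * (n * n)) + (2 * n * n + n * n))); last first.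
  have := ler_wpM2l n0 w2; have := mulr_ge0 n0 (ltW e0); clear; lra.
apply: lerD; apply: (le_trans (ler_normD _ _)); apply: lerD.
- by apply: (le_trans E2); rewrite ler_pM2l.
- by rewrite normrM ler_pM// (le_trans C1).
- rewrite normrM ler_pM//; first by apply: (le_trans E1); rewrite ler_pM2l.
  exact: le_trans S1 wy.
- apply: (le_trans S2); apply: (@le_trans _ _ (n * n * (1/2))); last first.
    have := mulr_ge0 n0 n0; clear; lra.
  by apply: ler_pM => //; rewrite ?sqr_ge0//; exact: le_trans wy w1.
Qed.

Lemma cderiv_cexp z : cderiv_at (@cexp R) z (cexp z).
Proof.
move=> e e0.
have E0 : 0 < normc (cexp z) by rewrite normc_cexp expR_gt0.
have [d d0 dP] := cderiv_cexp0 (divr_gt0 e0 E0).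
exists d => // w wd; have := dP w wd; rewrite add0r cexp0 mul1r => H.
rewrite cexpD (_ : _ - _ - _ = cexp z * (cexp w - 1 - w)); last by ring.
by rewrite normcM mulrC -ler_pdivlMr// mulrAC.
Qed.

Lemma holo_cexp : holo (@cexp R).
Proof. by apply: cderiv_holo => z; exists (cexp z); exact: cderiv_cexp. Qed.

(** With [h] this is the way to extend holomorphically the conjugate of the
    values of [h] on the real axis. *)
Lemma holo_reflect h : holo h -> holo (fun z => conjc (h (conjc z))).
Proof.
move=> hh; apply: cderiv_holo => z.
have [l H] := holo_cderiv (conjc z) hh; exists (conjc l) => e e0.
have [d d0 dP] := H _ e0; exists d => // w wd.
have -> : conjc (h (conjc (z + w))) - conjc (h (conjc z)) - conjc l * w =
    conjc (h (conjc z + conjc w) - h (conjc z) - l * conjc w).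
  by rewrite !rmorphB rmorphM rmorphD /= conjcK.
rewrite normc_conj -(normc_conj w).
by apply: dP; rewrite normc_conj.
Qed.

End ComplexDerivative.

(** * Goursat's theorem *)

Section Goursat.
Variable R : realType.

Lemma derive0_const (F : R -> R) (L : R) :
  (forall x, L < x -> is_derive x 1 F 0) ->
  forall x y, L < x -> L < y -> F x = F y.
Proof.
move=> H x y; wlog xy : x y / x < y.
  move=> W Lx Ly; have [xy|yx|->//] := ltgtP x y; first exact: W xy Lx Ly.
  by rewrite (W _ _ yx Ly Lx).
move=> Lx Ly.
have C : {within `[x, y], continuous F}.
  apply: derivable_within_continuous => z; rewrite in_itv /= => /andP[xz _].
  exact: (@ex_derive _ _ _ _ _ _ _ (H z (lt_le_trans Lx xz))).
have D z : z \in `]x, y[ -> is_derive z 1 F ((fun=> 0) z).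
  by rewrite in_itv /= => /andP[xz _]; apply: H; exact: lt_trans xz.
have [c _ /eqP] := MVT xy D C.
by rewrite mul0r subr_eq0 => /eqP.
Qed.

Definition primitive (f F : R -> R) := forall x : R, is_derive x 1 F (f x).

Lemma primitive_right (f : R -> R) (L : R) : continuous f ->
  exists F : R -> R, forall x, L < x -> is_derive x 1 F (f x).
Proof.
move=> cf; set mu := @lebesgue_measure R.
exists (fun x => (\int[mu]_(t in [set` Interval (BLeft L) (BRight x)]) f t)%R).
move=> x Lx.
have x1 : x < x + 1 by rewrite ltrDl.
have fi : mu.-integrable [set` Interval (BLeft L) (BRight (x + 1))] (EFin \o f).
  apply: continuous_compact_integrable; first exact: segment_compact.
  exact: continuous_subspaceT.
have Lx' : (BLeft L < BRight x)%E by [].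
have [] := continuous_FTC1 x1 fi Lx' (cf x).
by rewrite derive1E => D E; exact: DeriveDef D E.
Qed.

(** The primitives on half-lines differ by constants, so normalizing them at 0
    lets them be glued into one on the whole line. *)
Lemma primitive_exists (f : R -> R) : continuous f -> exists F, primitive f F.
Proof.
move=> cf.
have [G HG] := @choice R (R -> R) (fun L F => forall x, L < x -> is_derive x 1 F (f x))
  (fun L => primitive_right L cf).
have GE L L' x y : L < x -> L < y -> L' < x -> L' < y ->
    G L x - G L y = G L' x - G L' y.
  move=> Lx Ly L'x L'y; have E : (G L x - G L' x) = (G L y - G L' y).
    apply: (@derive0_const (fun z => G L z - G L' z) (Num.max L L')); rewrite ?gt_max ?Lx ?Ly//.
    move=> z; rewrite gt_max => /andP[Lz L'z]; rewrite -(subrr (f z)).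
    by apply: is_deriveB; apply: HG.
  lra.
exists (fun x => G (Num.min x 0 - 1) x - G (Num.min x 0 - 1) 0) => x.
pose L := Num.min x 0 - 2.
have Lx : L < x by rewrite /L; case: (leP x 0) => ?; lra.
have L0 : L < 0 by rewrite /L; case: (leP x 0) => ?; lra.
have E : \forall y \near x, G L y - G L 0 = G (Num.min y 0 - 1) y - G (Num.min y 0 - 1) 0.
  near=> y; apply: GE => //; [near: y; exact: lt_nbhsr|..].
    by case: (leP y 0) => ?; lra.
  by case: (leP y 0) => ?; lra.
have D : is_derive x 1 (fun y => G L y - G L 0) (f x).
  by rewrite -[f x]subr0; apply: is_deriveB; apply: HG.
exact: near_eq_is_derive E D.
Unshelve. all: by end_near. Qed.

(** This is the integral of f from a to b.  Goursat's argument uses only its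
    additivity along a chain of points and the mean value theorem, and both are
    immediate for differences of primitives. *)
Definition intg (f : R -> R) a b := xget (fun=> 0) (primitive f) b - xget (fun=> 0) (primitive f) a.

Lemma intgP (f F : R -> R) a b : primitive f F -> intg f a b = F b - F a.
Proof.
move=> PF; have PG : primitive f (xget (fun=> 0) (primitive f)) by exact: xgetI PF.
rewrite /intg; set G := xget _ _ in PG *.
pose L := Num.min a b - 1.
have La : L < a by rewrite /L; case: (leP a b) => ?; lra.
have Lb : L < b by rewrite /L; case: (leP a b) => ?; lra.
have : G a - F a = G b - F b; last by lra.
apply: (@derive0_const (fun z => G z - F z) L) => // z _.
by rewrite -(subrr (f z)); apply: is_deriveB; [exact: PG|exact: PF].
Qed.

Lemma intg_chain (f : R -> R) a b c : intg f a b + intg f b c = intg f a c.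
Proof. by rewrite /intg; ring. Qed.

Lemma intgB_MVT (f g : R -> R) a b : continuous f -> continuous g -> a < b ->
  exists2 x, a <= x <= b & intg f a b - intg g a b = (f x - g x) * (b - a).
Proof.
move=> /primitive_exists[F PF] /primitive_exists[G PG] ab.
rewrite (intgP _ _ PF) (intgP _ _ PG).
have D z : z \in `]a, b[ -> is_derive z 1 (fun z => F z - G z) ((fun z => f z - g z) z).
  by move=> _; apply: is_deriveB; [exact: PF|exact: PG].
have C : {within `[a, b], continuous (fun z => F z - G z)}.
  apply: derivable_within_continuous => z _; apply: derivableB.
    exact: (@ex_derive _ _ _ _ _ _ _ (PF z)).
  exact: (@ex_derive _ _ _ _ _ _ _ (PG z)).
have [c] := MVT ab D C; rewrite in_itv /= => /andP[ac cb] E.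
by exists c; rewrite ?(ltW ac) ?(ltW cb)// -E; ring.
Qed.

(** The integral of A dx + B dy along the positively oriented boundary of the
    rectangle with lower left corner (a, c), width w and height h. *)
Definition circulation (A B : R -> R -> R) (a c w h : R) :=
  (intg (A ^~ c) a (a + w) - intg (A ^~ (c + h)) a (a + w))
  + (intg (B (a + w)) c (c + h) - intg (B a) c (c + h)).

Lemma circulation_quarters A B a c w h :
  let w2 := w / 2 in let h2 := h / 2 in
  circulation A B a c w h =
    circulation A B a c w2 h2 + circulation A B (a + w2) c w2 h2
    + (circulation A B a (c + h2) w2 h2 + circulation A B (a + w2) (c + h2) w2 h2).
Proof.
move=> w2 h2; rewrite /circulation.
have -> : a + w2 + w2 = a + w by rewrite /w2; lra.
have -> : c + h2 + h2 = c + h by rewrite /h2; lra.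
rewrite -(intg_chain (A ^~ c) a (a + w2) (a + w)).
rewrite -(intg_chain (A ^~ (c + h)) a (a + w2) (a + w)).
rewrite -(intg_chain (B a) c (c + h2) (c + h)).
rewrite -(intg_chain (B (a + w)) c (c + h2) (c + h)).
ring.
Qed.

Lemma bisection_limit (a : nat -> R) (w : R) : 0 < w ->
  (forall n, a n.+1 = a n \/ a n.+1 = a n + w / 2 ^+ n.+1) ->
  exists p, forall n, a n <= p <= a n + w / 2 ^+ n.
Proof.
move=> w0 H.
have p2 n : 0 < w / 2 ^+ n :> R by rewrite divr_gt0// exprn_gt0.
have p2S n : w / 2 ^+ n.+1 = (w / 2 ^+ n) / 2 by rewrite exprSr invfM mulrA.
have step n : a n <= a n.+1 /\ a n.+1 + w / 2 ^+ n.+1 <= a n + w / 2 ^+ n.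
  by have := p2 n; have [->|->] := H n; rewrite p2S => ?; split; lra.
have mono n k : a n <= a (n + k)%N /\ a (n + k)%N + w / 2 ^+ (n + k) <= a n + w / 2 ^+ n.
  elim: k => [|k [IH1 IH2]]; first by rewrite addn0.
  have [] := step (n + k)%N; rewrite addnS => S1 S2; split.
    exact: le_trans IH1 S1.
  exact: le_trans S2 IH2.
have ub n m : a m <= a n + w / 2 ^+ n.
  have [nm|mn] := leqP n m.
    have [_] := mono n (m - n)%N; rewrite subnKC//; apply: le_trans.
    by rewrite lerDl ltW.
  have [+ _] := mono m (n - m)%N; rewrite subnKC ?(ltnW mn)// => /le_trans; apply.
  by rewrite lerDl ltW.
have hs : has_sup (range a).
  by split; [exists (a 0%N); exists 0%N|exists (a 0%N + w / 2 ^+ 0) => _ [m _ <-]].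
exists (sup (range a)) => n; apply/andP; split.
  by apply: ub_le_sup; [exact: hs.2|exists n].
by apply: ge_sup; [exact: hs.1|move=> _ [m _ <-]].
Qed.

(** The quarters are chosen one inside the other; their lower left corners
    increase in each coordinate and converge to the common point. *)
Lemma bisection (P : R -> R -> R -> R -> Prop) a0 c0 w h :
  (forall a c w h, P a c w h -> exists a' c',
    [/\ a' = a \/ a' = a + w / 2, c' = c \/ c' = c + h / 2
      & P a' c' (w / 2) (h / 2)]) ->
  0 < w -> 0 < h -> P a0 c0 w h ->
  exists p q, forall d, 0 < d -> exists a c w' h',
    [/\ 0 < w' <= d, 0 < h' <= d, a <= p <= a + w', c <= q <= c + h' & P a c w' h'].
Proof.
move=> step w0 h0 P0.
have /choice[S HS] : forall s : R * R * nat, exists t : R * R,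
    P s.1.1 s.1.2 (w / 2 ^+ s.2) (h / 2 ^+ s.2) ->
    [/\ t.1 = s.1.1 \/ t.1 = s.1.1 + w / 2 ^+ s.2.+1,
        t.2 = s.1.2 \/ t.2 = s.1.2 + h / 2 ^+ s.2.+1
      & P t.1 t.2 (w / 2 ^+ s.2.+1) (h / 2 ^+ s.2.+1)].
  move=> [[a c] n] /=.
  have [Pac|nP] := pselect (P a c (w / 2 ^+ n) (h / 2 ^+ n)); last by exists (0, 0).
  have [a' [c' H]] := step _ _ _ _ Pac; exists (a', c') => _ /=.
  by rewrite !exprSr !invfM !mulrA.
pose fix s n := if n is n'.+1 then S (s n', n') else (a0, c0).
have Ps n : P (s n).1 (s n).2 (w / 2 ^+ n) (h / 2 ^+ n).
  elim: n => [|n IH]; first by rewrite expr0 !divr1.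
  by have [] := HS (s n, n) IH.
have [p pP] : exists p, forall n, (s n).1 <= p <= (s n).1 + w / 2 ^+ n.
  apply: (@bisection_limit (fun n => (s n).1)) => // n.
  by have [] := HS (s n, n) (Ps n).
have [q qP] : exists p, forall n, (s n).2 <= p <= (s n).2 + h / 2 ^+ n.
  apply: (@bisection_limit (fun n => (s n).2)) => // n.
  by have [] := HS (s n, n) (Ps n).
exists p, q => d d0.
pose n := Num.truncn ((w + h) / d).
have nP : (w + h) / d < 2 ^+ n.+1.
  apply: (lt_le_trans (truncnS_gt _)); rewrite -natrX ler_nat.
  exact: (ltnW (ltn_expl _ _)).
have p2 : 0 < 2 ^+ n.+1 :> R by rewrite exprn_gt0.
move: nP; rewrite ltr_pdivrMr// mulrC => nP.
exists (s n.+1).1, (s n.+1).2, (w / 2 ^+ n.+1), (h / 2 ^+ n.+1); split.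
- by rewrite divr_gt0//= ler_pdivrMr//; lra.
- by rewrite divr_gt0//= ler_pdivrMr//; lra.
- exact: pP.
- exact: qP.
- exact: Ps.
Qed.

Lemma dist_le_width (x y a w : R) : a <= y -> y <= a + w -> a <= x -> x <= a + w ->
  `|x - y| <= w.
Proof. by move=> ? ? ? ?; rewrite ler_norml; apply/andP; split; lra. Qed.

Lemma normB_le_half (x y k s : R) : `|x| <= k / 4 * s -> `|y| <= k / 4 * s ->
  `|x - y| <= k / 2 * s.
Proof. by move=> ? ?; apply: (le_trans (ler_normB _ _)); lra. Qed.

Definition frechet2 (A : R -> R -> R) x0 y0 ax ay := forall e, 0 < e ->
  exists2 d, 0 < d & forall x y, `|x - x0| <= d -> `|y - y0| <= d ->
    `|A x y - A x0 y0 - ax * (x - x0) - ay * (y - y0)| <= e * (`|x - x0| + `|y - y0|).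

(** The form is closed, but its coefficients are merely differentiable.  A
    nonzero circulation would stay comparable with the area along some nest of
    quarters; near their common point the mean value theorem replaces the
    integrals by values, whose linear parts cancel because the form is closed, and
    the remainder is small compared with the area. *)
Lemma goursat (A B : R -> R -> R) a c w h :
  (forall y, continuous (A ^~ y)) -> (forall x, continuous (B x)) ->
  (forall x y, exists ax k by_, frechet2 A x y ax k /\ frechet2 B x y k by_) ->
  0 < w -> 0 < h -> circulation A B a c w h = 0.
Proof.
move=> cA cB dAB w0 h0; apply/eqP/negPn/negP => W0.
have W1 : 0 < `|circulation A B a c w h| by rewrite normr_gt0.
pose k := `|circulation A B a c w h| / (w + h) ^+ 2.
have wh : 0 < w + h by lra.
have k0 : 0 < k by rewrite divr_gt0// exprn_gt0.
(* (w + h)^2 stands for the area: it too is divided by 4 in each quarter, and it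
   dominates the square of the diameter. *)
pose P a c w h := k * (w + h) ^+ 2 <= `|circulation A B a c w h|.
have [] := @bisection P a c w h _ w0 h0 _.
- move=> a' c' w' h'; rewrite /P circulation_quarters /=.
  set c1 := circulation A B a' c' _ _; set c2 := circulation A B (a' + _) c' _ _.
  set c3 := circulation A B a' (c' + _) _ _.
  set c4 := circulation A B (a' + _) (c' + _) _ _ => H.
  have -> : k * (w' / 2 + h' / 2) ^+ 2 = k * (w' + h') ^+ 2 / 4 by field.
  have T : k * (w' + h') ^+ 2 <= `|c1| + `|c2| + (`|c3| + `|c4|).
    apply: (le_trans H); apply: (le_trans (ler_normD _ _)).
    by apply: lerD; exact: ler_normD.
  have [H1|H1] := leP (k * (w' + h') ^+ 2 / 4) `|c1|.
    by exists a', c'; split; [left|left|].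
  have [H2|H2] := leP (k * (w' + h') ^+ 2 / 4) `|c2|.
    by exists (a' + w' / 2), c'; split; [right|left|].
  have [H3|H3] := leP (k * (w' + h') ^+ 2 / 4) `|c3|.
    by exists a', (c' + h' / 2); split; [left|right|].
  by exists (a' + w' / 2), (c' + h' / 2); split; [right|right|rewrite -/c4; lra].
- by rewrite /P /k divfK// lt0r_neq0// exprn_gt0.
move=> p [q H]; have [ax [l [b [dA dB]]]] := dAB p q.
have k8 : 0 < k / 4 by rewrite divr_gt0.
have [d1 d10 D1] := dA _ k8; have [d2 d20 D2] := dB _ k8.
have dm : 0 < Num.min d1 d2 by rewrite lt_min d10.
have [a' [c' [w' [h' [/andP[w'0 w'd] /andP[h'0 h'd] /andP[p1 p2] /andP[q1 q2]]]]]] := H _ dm.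
move: w'd h'd; rewrite !le_min => /andP[wd1 wd2] /andP[hd1 hd2]; rewrite /P.
have aw : a' < a' + w' by rewrite ltrDl.
have ch : c' < c' + h' by rewrite ltrDl.
have [x /andP[x1 x2] Ex] := intgB_MVT (cA c') (cA (c' + h')) aw.
have [y /andP[y1 y2] Ey] := intgB_MVT (cB (a' + w')) (cB a') ch.
rewrite /circulation Ex Ey.
have nx z := @dist_le_width z p a' w' p1 p2.
have ny z := @dist_le_width z q c' h' q1 q2.
have bound (E : R -> R -> R) (e1 e2 d : R) : w' <= d -> h' <= d ->
   (forall x y, `|x - p| <= d -> `|y - q| <= d ->
    `|E x y - E p q - e1 * (x - p) - e2 * (y - q)| <= k / 4 * (`|x - p| + `|y - q|)) ->
   forall x y, a' <= x -> x <= a' + w' -> c' <= y -> y <= c' + h' ->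
    `|E x y - E p q - e1 * (x - p) - e2 * (y - q)| <= k / 4 * (w' + h').
  move=> wd hd Q x' y' ? ? ? ?; apply: (le_trans (Q _ _ _ _)).
  - by apply: (le_trans (nx _ _ _)).
  - by apply: (le_trans (ny _ _ _)).
  - by rewrite ler_pM2l// lerD// ?nx ?ny.
have B1 := bound _ _ _ _ wd1 hd1 D1; have B2 := bound _ _ _ _ wd2 hd2 D2.
have a0 : a' <= a' by []. have c0 : c' <= c' by [].
have := B1 x c' x1 x2 c0 (ltW ch); have := B1 x (c' + h') x1 x2 (ltW ch) (lexx _).
have := B2 (a' + w') y (ltW aw) (lexx _) y1 y2; have := B2 a' y a0 (ltW aw) y1 y2.
set r1 := _ - l * (a' - p) - _; set r2 := _ - l * (a' + w' - p) - _.
set r3 := _ - _ - l * (c' + h' - q); set r4 := _ - _ - l * (c' - q).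
move=> R1 R2 R3 R4.
have -> : (A x c' - A x (c' + h')) * (a' + w' - a') +
    (B (a' + w') y - B a' y) * (c' + h' - c') = (r4 - r3) * w' + (r2 - r1) * h'.
  by rewrite /r1 /r2 /r3 /r4; ring.
have n1 : `|(r4 - r3) * w' + (r2 - r1) * h'| <= k / 2 * (w' + h') * (w' + h').
  rewrite [leRHS]mulrDr; apply: (le_trans (ler_normD _ _)); apply: lerD; rewrite normrM.
    rewrite (gtr0_norm w'0) ler_pM2r//; exact: normB_le_half.
  rewrite (gtr0_norm h'0) ler_pM2r//; exact: normB_le_half.
move=> /le_trans /(_ n1); apply/negP; rewrite -ltNge expr2.
have : 0 < k * ((w' + h') * (w' + h')) by have wh'0 := addr_gt0 w'0 h'0; exact: mulr_gt0 k0 (mulr_gt0 wh'0 wh'0).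
clear; lra.
Qed.

End Goursat.

(** * The mean value property and the maximum principle *)

Section MaximumPrinciple.
Variable R : realType.
Local Notation C := R[i].

Lemma frechet2_continuous1 (A : R -> R -> R) x y ax ay :
  frechet2 A x y ax ay -> {for x, continuous (A ^~ y)}.
Proof.
move=> H; apply/cvgrPdist_le => /= e e0.
have [d d0 D] := H 1 ltr01.
have k0 : 0 < `|ax| + 1 by rewrite ltr_wpDl.
near=> t.
have td : `|t - x| <= d by near: t; exact: cvgr_distC_le.
have te : (`|ax| + 1) * `|t - x| <= e.
  by rewrite mulrC -ler_pdivlMr//; near: t; apply: cvgr_distC_le => //; rewrite divr_gt0.
rewrite distrC; apply: le_trans te.
have := D t y td; rewrite subrr normr0 => /(_ (ltW d0)).
rewrite mulr0 subr0 addr0 mul1r => B.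
rewrite (_ : A t y - A x y = (A t y - A x y - ax * (t - x)) + ax * (t - x)); last by ring.
apply: (le_trans (ler_normD _ _)); rewrite normrM mulrDl mul1r addrC.
by rewrite lerD2l.
Unshelve. all: by end_near. Qed.

Lemma frechet2_swap (A : R -> R -> R) x y ax ay :
  frechet2 A x y ax ay -> frechet2 (fun s t => A t s) y x ay ax.
Proof.
move=> H e /H[d d0 D]; exists d => // s t sd td.
by rewrite addrAC [X in _ <= _ * X]addrC; exact: D.
Qed.

(** The Cauchy-Riemann equations: the form Im k dx + Re k dy, which is the
    imaginary part of k(z) dz, is closed. *)
Lemma cderiv_frechet2 (k : C -> C) x y l : cderiv_at k (x +i* y) l ->
  frechet2 (fun s t => Re (k (s +i* t))) x y (Re l) (- Im l) /\
  frechet2 (fun s t => Im (k (s +i* t))) x y (Im l) (Re l).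
Proof.
move=> H; suff G e : 0 < e -> exists2 d, 0 < d & forall s t, `|s - x| <= d -> `|t - y| <= d ->
    normc (k (s +i* t) - k (x +i* y) - l * ((s - x) +i* (t - y))) <= e * (`|s - x| + `|t - y|).
  split=> e /G[d d0 D]; exists d => // s t sd td; apply: le_trans (D s t sd td).
    apply: le_trans (Re_le_normc _); rewrite le_eqVlt; apply/orP; left; apply/eqP; congr `|_|.
    by case: (k (s +i* t)) (k (x +i* y)) l {H G D} => [? ?] [? ?] [? ?] /=; ring.
  apply: le_trans (Im_le_normc _); rewrite le_eqVlt; apply/orP; left; apply/eqP; congr `|_|.
  by case: (k (s +i* t)) (k (x +i* y)) l {H G D} => [? ?] [? ?] [? ?] /=; ring.
move=> /[dup] e0 /H[d d0 D]; exists (d / 2); first by rewrite divr_gt0.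
move=> s t sd td; have := D ((s - x) +i* (t - y)).
have -> : x +i* y + ((s - x) +i* (t - y)) = s +i* t.
  by apply/eqP; rewrite eq_complex /= !addrA ![_ + s]addrC ![_ + t]addrC !addrK !eqxx.
have N := normc_le_ReIm ((s - x) +i* (t - y)); rewrite /= in N.
move=> /(_ _)/le_trans; apply; last by rewrite ler_pM2l.
by apply: (le_trans N); lra.
Qed.

Lemma cexp_pi2 (x : R) : cexp (x +i* (pi *+ 2)) = cexp (x +i* 0).
Proof. by rewrite /cexp /= cos2pi sin2pi cos0 sin0. Qed.

(** A weak form of the mean value property.  By Goursat's theorem for
    K(z + exp(u + iv)), the mean of Re K over the circle of radius r equals its mean
    over a circle of small radius d', on which Re K is within e of Re K(z). *)
Lemma circle_approx_center (K : C -> C) z r e : holo K -> 0 < r -> 0 < e ->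
  exists2 w, normc w = r & Re (K z) - e <= Re (K (z + w)).
Proof.
move=> hK r0 e0.
pose k := fun w => K (z + cexp w).
have hk : holo k.
  apply: (@holo_comp R (fun w => z + cexp w) K) => //.
  by apply: holoD; [exact: holo_cst|exact: holo_cexp].
pose P u v := Re (k (u +i* v)); pose Q u v := Im (k (u +i* v)).
have dPQ x y : exists ax l by_, frechet2 Q x y ax l /\ frechet2 P x y l by_.
  have [l /cderiv_frechet2[H1 H2]] := holo_cderiv (x +i* y) hk.
  by exists (Im l), (Re l), (- Im l).
have cQ y : continuous (Q ^~ y).
  by move=> x; have [? [? [? [/frechet2_continuous1 ? _]]]] := dPQ x y.
have cP x : continuous (P x).
  by move=> y; have [? [? [? [_ /frechet2_swap/frechet2_continuous1 ?]]]] := dPQ x y.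
have [l Kl] := holo_cderiv z hK.
have l0 : 0 < normc l + 1 by rewrite ltr_wpDl ?normc_ge0.
have [d d0 D] := Kl 1 ltr01.
(* d' is below r and so small that K varies by at most e within distance d'. *)
pose d' := Num.min d (Num.min (r / 2) (e / (normc l + 1))).
have d'0 : 0 < d' by rewrite !lt_min d0 !divr_gt0.
have d'r : d' < r by rewrite !gt_min ltr_pdivrMr// ltr_pMr// ltr1n orbT.
have [w0 h0] : 0 < ln r - ln d' /\ (0:R) < pi *+ 2.
  by rewrite subr_gt0 ltr_ln ?posrE// d'r pmulrn_lgt0 ?pi_gt0.
have := goursat (ln d') 0 cQ cP dPQ w0 h0.
rewrite /circulation add0r (_ : ln d' + (ln r - ln d') = ln r); last by ring.
have -> : Q ^~ 0 = Q ^~ (pi *+ 2).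
  by apply/funext => u; rewrite /Q /k cexp_pi2.
rewrite subrr add0r.
have pi0 : (0:R) < pi *+ 2 by [].
(* Equal integrals have a common value, attained at the same angle v. *)
have [v _ ->] := intgB_MVT (cP (ln r)) (cP (ln d')) pi0.
rewrite subr0 => /eqP; rewrite mulf_eq0 (gt_eqF h0) orbF subr_eq0 => /eqP E.
exists (cexp (ln r +i* v)); first by rewrite normc_cexp /= lnK// posrE.
rewrite -/(k _) -/(P _ _) E /P /k.
set w := cexp _; have wd : normc w = d' by rewrite normc_cexp /= lnK// posrE.
have := D w; rewrite wd ge_min lexx => /(_ isT); rewrite mul1r => B.
have B2 : normc (K (z + w) - K z) <= e.
  rewrite (_ : K (z + w) - K z = (K (z + w) - K z - l * w) + l * w); last by ring.
  apply: (le_trans (le_normcD _ _)); rewrite normcM wd.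
  apply: (@le_trans _ _ ((normc l + 1) * d')); first by rewrite mulrDl mul1r addrC lerD2l.
  by rewrite mulrC -ler_pdivlMr// !ge_min lexx !orbT.
have := le_trans (Re_le_normc _) B2; rewrite ler_norml => /andP[+ _].
by case: (K (z + w)) (K z) => [? ?] [? ?] /=; lra.
Qed.


Lemma normc_dist (z w : C) : `|normc z - normc w| <= normc (z - w).
Proof.
have H (a b : C) : normc a - normc b <= normc (a - b).
  by rewrite lerBlDr -{1}(subrK b a) le_normcD.
rewrite ler_norml H andbT lerNl opprB (le_trans (H _ _))//.
by rewrite -normcN opprB.
Qed.

Lemma holo_normc_continuous (H : C -> C) : holo H ->
  continuous (fun p : R * R => normc (H (p.1 +i* p.2)) : R).
Proof.
move=> hH p; apply/cvgrPdist_le => /= e e0.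
have [l Hl] := holo_cderiv (p.1 +i* p.2) hH; have [d d0 D] := Hl 1 ltr01.
have l0 : 0 < normc l + 1 by rewrite ltr_wpDl ?normc_ge0.
pose d' := Num.min d (e / (normc l + 1)).
have d'0 : 0 < d' / 2 by rewrite divr_gt0// lt_min d0 divr_gt0.
near=> t.
have t1 : `|t.1 - p.1| <= d' / 2.
  by near: t; apply: cvgr_distC_le => //; exact: cvg_fst.
have t2 : `|t.2 - p.2| <= d' / 2.
  by near: t; apply: cvgr_distC_le => //; exact: cvg_snd.
set w := (t.1 - p.1) +i* (t.2 - p.2).
have wd' : normc w <= d' by apply: (le_trans (normc_le_ReIm _)) => /=; lra.
have -> : t.1 +i* t.2 = p.1 +i* p.2 + w.
  by apply/eqP; rewrite eq_complex /= [p.1 + _]addrC [p.2 + _]addrC !subrK !eqxx.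
move: (p.1 +i* p.2) D {Hl} => z D; rewrite distrC; apply: (le_trans (normc_dist _ _)).
move: wd'; rewrite le_min => /andP[/D]; rewrite mul1r => B wd.
rewrite (_ : H (z + w) - H z = (H (z + w) - H z - l * w) + l * w); last by ring.
apply: (le_trans (le_normcD _ _)); rewrite normcM.
apply: (@le_trans _ _ ((normc l + 1) * normc w)); first by rewrite mulrDl mul1r addrC lerD2l.
by rewrite mulrC -ler_pdivlMr.
Unshelve. all: by end_near. Qed.

(** At an interior maximum of |H| + e |z|^2, rotate H to be positive there and
    absorb the linear part of e |z|^2 into it: the real part of the resulting
    holomorphic function drops by e r^2 from the centre to every small circle,
    against the mean value property.  The boundary of O enters only through the
    alternative that each point satisfies the bound or is interior. *)
Lemma maximum_principle (H : C -> C) (O : set (R * R)) (B : R) :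
  holo H -> compact O ->
  (forall p, O p -> normc (H (p.1 +i* p.2)) <= B \/
     exists2 r : R, 0 < r & forall w, normc w <= r -> O (p.1 + Re w, p.2 + Im w)) ->
  forall p, O p -> normc (H (p.1 +i* p.2)) <= B.
Proof.
move=> hH cO HO p Op; rewrite leNgt; apply/negP => Bp.
have ne : O !=set0 by exists p.
pose sq (q : R * R) := q.1 ^+ 2 + q.2 ^+ 2.
have csq : continuous sq.
  move=> q; apply: cvgD; apply: (@continuous_comp _ _ _ _ (fun x : R => x ^+ 2)).
  - exact: cvg_fst.
  - exact: exprn_continuous.
  - exact: cvg_snd.
  - exact: exprn_continuous.
have [N _ HN] := compact_EVT_max ne cO (continuous_subspaceT csq).
have sq0 q : 0 <= sq q by rewrite addr_ge0 ?sqr_ge0.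
have N1 : 0 < sq N + 1 by rewrite ltr_wpDl.
pose g := normc (H (p.1 +i* p.2)) - B.
have g0 : 0 < g by rewrite subr_gt0.
(* e is so small that a maximum point of |H| + e |z|^2 still violates the bound B. *)
pose e := g / (sq N + 1) / 2.
have e0 : 0 < e by rewrite !divr_gt0.
have eN : e * sq N < g.
  have : e * (sq N + 1) = g / 2 by rewrite /e; field; rewrite lt0r_neq0.
  lra.
pose f (q : R * R) : R := normc (H (q.1 +i* q.2)) + e * sq q.
have cf : continuous f.
  move=> q; apply: cvgD; first exact: holo_normc_continuous.
  by apply: cvgMr; exact: csq.
have [m mO Hm] := compact_EVT_max ne cO (continuous_subspaceT cf).
have Om : O m by move: mO; rewrite inE.
have fp : f p <= f m by apply: Hm; rewrite inE.
have sm : sq m <= sq N by apply: HN; rewrite inE.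
have esm : e * sq m <= e * sq N by rewrite ler_pM2l.
have Bm : B < normc (H (m.1 +i* m.2)).
  have := mulr_ge0 (ltW e0) (sq0 p).
  by move: fp eN; rewrite /f /g; lra.
have [|[r r0 Hr]] := HO m Om; first by rewrite leNgt Bm.
set z := m.1 +i* m.2 in Bm.
have [c c1 cH] := phaseP (H z).
pose K w := c * H w + (e *+ 2)%:C * conjc z * (w - z).
have hK : holo K.
  apply: holoD; first by apply: holoM => //; exact: holo_cst.
  by apply: holoM; [exact: holo_cst|apply: holoD; [exact: holo_id|exact: holo_cst]].
have er : 0 < e * r ^+ 2 / 2 by rewrite divr_gt0// mulr_gt0// exprn_gt0.
have [w wr] := circle_approx_center z hK r0 er.
rewrite /K subrr mulr0 addr0 cH addrAC subrr add0r raddfD /=.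
have := Re_le_normc (c * H (z + w)); rewrite normcM c1 mul1r => /(le_trans (ler_norm _)) R1.
have Omw : O (m.1 + Re w, m.2 + Im w) by apply: Hr; rewrite wr.
have fm : f (m.1 + Re w, m.2 + Im w) <= f m by apply: Hm; rewrite inE.
have w2 := normc_sqr w; rewrite wr in w2.
have -> : Re ((e *+ 2)%:C * conjc z * w) = 2 * e * (m.1 * Re w + m.2 * Im w).
  by case: w {wr R1 Omw fm w2} => ? ? /=; rewrite mulr2n; ring.
move: fm; rewrite /f /sq /= -/z.
have -> : (m.1 + Re w) +i* (m.2 + Im w) = z + w by case: w {wr R1 Omw w2}.
move: R1; move: (Re (c * _)) (normc (H (z + w))) (normc (H z)) => a1 a2 a3 R1 fm F.
have : e * r ^+ 2 = e * (Re w ^+ 2 + Im w ^+ 2) by rewrite w2.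
have := er; clear -R1 fm F; lra.
Qed.

End MaximumPrinciple.

(** * The Phragmen-Lindelof principle in the upper half-plane *)

Section PhragmenLindelof.
Variable R : realType.
Local Notation C := R[i].

(** Harmonic majorants of log |h| of the form Re p. *)
Lemma maximum_principle_exp (h p : C -> C) (O : set (R * R)) :
  holo h -> holo p -> compact O ->
  (forall q, O q -> normc (h (q.1 +i* q.2)) <= expR (Re (p (q.1 +i* q.2))) \/
     exists2 r : R, 0 < r & forall w, normc w <= r -> O (q.1 + Re w, q.2 + Im w)) ->
  forall q, O q -> normc (h (q.1 +i* q.2)) <= expR (Re (p (q.1 +i* q.2))).
Proof.
move=> hh hp cO HO q Oq.
have E z : (normc (h z * cexp (- 1 * p z)) <= 1) = (normc (h z) <= expR (Re (p z))).
  rewrite normcM normc_cexp.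
  have -> : Re (- 1 * p z) = - Re (p z) by case: (p z) => ? ? /=; ring.
  by rewrite expRN ler_pdivrMr ?expR_gt0// mul1r.
rewrite -E; apply: (@maximum_principle R (fun z => h z * cexp (- 1 * p z)) O) => //.
  apply: holoM => //; apply: (@holo_comp R (fun z => - 1 * p z)).
    by apply: holoM => //; exact: holo_cst.
  exact: holo_cexp.
by move=> t /HO; rewrite E.
Qed.

Lemma ler_expR_limit (a b k : R) :
  (forall d, 0 < d -> exists2 t, t <= d & a <= expR (b + t)) -> a <= expR b.
Proof.
move=> H; rewrite leNgt; apply/negP => ba.
have a0 : 0 < a := lt_trans (expR_gt0 _) ba.
have lb : b < ln a by rewrite -ltr_expR lnK.
have [|t td] := H ((ln a - b) / 2); first by rewrite divr_gt0// subr_gt0.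
rewrite -(@lnK _ a) ?posrE// ler_expR; lra.
Qed.

Lemma compact_rectangle (a b c d : R) (g : R * R -> R) : continuous g ->
  compact [set p : R * R | [/\ a <= p.1 <= b, c <= p.2 <= d & 0 <= g p]].
Proof.
move=> cg; apply: (@subclosed_compact _ _ (`[a, b] `*` `[c, d])); last first.
- by move=> p [? ? _]; split; rewrite /= in_itv.
- by apply: compact_setX; exact: segment_compact.
have -> : [set p : R * R | [/\ a <= p.1 <= b, c <= p.2 <= d & 0 <= g p]] =
    (fst @^-1` `[a, b]) `&` ((snd @^-1` `[c, d]) `&` (g @^-1` [set x | 0 <= x])).
  apply/seteqP; split => p /=; rewrite !in_itv /=; first by case.
  by move=> [? []].
apply: closedI; last apply: closedI.
- by apply: preimage_closed; [move=> *; exact: cvg_fst|exact: itv_closed].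
- by apply: preimage_closed; [move=> *; exact: cvg_snd|exact: itv_closed].
- by apply: preimage_closed => //; exact: closed_ge.
Qed.

Variables (h : C -> C) (L s : R).
Hypotheses (L0 : 0 <= L) (s0 : 0 < s).
Hypothesis hR : forall x : R, normc (h x%:C) <= 1.
Hypothesis hg : forall z, normc (h z) <= expR (L + s * normc z).

(** In the sector below the line x = mu y the majorant is
    L + s (1 + mu) y + tau q, with q = 2xy + mu (x^2 - y^2) harmonic and at least
    mu (x^2 + y^2) there.  On the side x = rho the term tau q makes up for s |z| when
    tau = s / (mu rho), and this tau tends to 0 as rho grows. *)
Lemma sector_bound (mu x y : R) : holo h -> 0 < mu <= 1 -> 0 <= y -> mu * y <= x ->
  normc (h (x +i* y)) <= expR (L + s * (1 + mu) * y).
Proof.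
move=> hh /andP[mu0 mu1] y0 xy; apply: ler_expR_limit => // d d0.
pose q (x y : R) := 2 * x * y + mu * (x ^+ 2 - y ^+ 2).
pose rho := Num.max x (s * q x y / (mu * d)) + 1.
have xrho : x < rho by rewrite ltr_pwDr// le_max lexx.
have rho0 : 0 < rho by apply: le_lt_trans xrho; rewrite (le_trans _ xy)// mulr_ge0// ltW.
have mr0 : 0 < mu * rho by rewrite mulr_gt0.
pose tau := s / (mu * rho).
have tau0 : 0 < tau by rewrite divr_gt0.
have tauE : tau * (mu * rho) = s by rewrite /tau divfK// lt0r_neq0.
exists (tau * q x y).
  (* The value of rho was chosen to make tau q(x, y) at most d. *)
  have : s * q x y / (mu * d) <= rho by rewrite ler_wpDr// le_max lexx orbT.
  rewrite ler_pdivrMr ?mulr_gt0// => H.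
  by rewrite /tau mulrAC ler_pdivrMr//; apply: (le_trans H); rewrite le_eqVlt; apply/orP; left; apply/eqP; ring.
pose p (z : C) : C := L%:C + ((0 -i* (s * (1 + mu))) * z + (tau * mu -i* tau) * (z * z)).
have hp : holo p.
  apply: holoD; first exact: holo_cst.
  apply: holoD; apply: holoM; do ?[exact: holo_cst|exact: holo_id].
  by apply: holoM; exact: holo_id.
have pE u v : Re (p (u +i* v)) = L + s * (1 + mu) * v + tau * q u v.
  by rewrite /p /q /=; ring.
move: p hp pE => p hp pE.
have cg : continuous (fun p : R * R => p.1 - mu * p.2).
  move=> t; apply: cvgB; first exact: cvg_fst.
  by apply: cvgMr; exact: cvg_snd.
have cO := @compact_rectangle 0 rho 0 (rho / mu) _ cg.
rewrite -pE; apply: (maximum_principle_exp hh hp cO _ (q := (x, y))); last first.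
  have x0 : 0 <= x by apply: le_trans xy; rewrite mulr_ge0// ltW.
  have yr : y <= rho / mu by rewrite ler_pdivlMr// mulrC (le_trans xy)// ltW.
  by rewrite /= subr_ge0 xy x0 y0 (ltW xrho) yr.
move=> [u v] [/= /andP[u0 ur] /andP[v0 vr]]; rewrite subr_ge0 => vu.
rewrite pE; have [v1|v1] := leP v 0.
  left; have -> : v = 0 by lra.
  apply: (le_trans (hR u)); rewrite -expR0 ler_expR.
  have -> : q u 0 = mu * u ^+ 2 by rewrite /q; ring.
  by rewrite mulr0 addr0 addr_ge0// mulr_ge0 ?(ltW tau0)// mulr_ge0 ?sqr_ge0 ?(ltW mu0).
have nuv : normc (u +i* v) <= u + v.
  by apply: (le_trans (normc_le_ReIm _)); rewrite /= !ger0_norm.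
have hb := hg (u +i* v).
have hb2 : normc (h (u +i* v)) <= expR (L + s * (u + v)).
  by apply: (le_trans hb); rewrite ler_expR lerD2l ler_pM2l.
have muv0 : 0 <= mu * v * v by rewrite !mulr_ge0// ltW.
have uv2 : mu * v * v <= u * v by rewrite ler_pM2r.
have mu2 : 0 <= mu * u * u by rewrite !mulr_ge0// ltW.
have [u1|u1] := leP u (mu * v).
  left; apply: (le_trans hb2); rewrite ler_expR -addrA lerD2l.
  have q0 : 0 <= tau * q u v by apply: mulr_ge0; [exact: ltW|rewrite /q; nra].
  have : s * u <= s * (mu * v) by rewrite ler_pM2l.
  lra.
have [u2|u2] := leP rho u.
  left; apply: (le_trans hb2); rewrite ler_expR -addrA lerD2l.
  have ue : u = rho by lra.
  have : tau * (mu * rho) * rho <= tau * q u v.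
    by rewrite -mulrA ler_pM2l// /q ue; rewrite ue in uv2; lra.
  have : 0 <= s * mu * v by rewrite !mulr_ge0// ltW.
  rewrite tauE ue; lra.
right; exists (Num.min ((u - mu * v) / 2) (Num.min v (rho - u))).
  by rewrite !lt_min divr_gt0 ?subr_gt0//= v1 .
move=> w; rewrite !le_min => /andP[w1 /andP[w2 w3]].
have := le_trans (Re_le_normc w) w1; have := le_trans (Re_le_normc w) w3.
have := le_trans (Im_le_normc w) w1; have := le_trans (Im_le_normc w) w2.
rewrite !ler_norml => /andP[a1 a2] /andP[a3 a4] /andP[a5 a6] /andP[a7 a8].
have mI : mu * Im w <= (u - mu * v) / 2.
  have [I0|I0] := leP 0 (Im w); first by apply: (le_trans _ a4); rewrite ler_piMl.
  by apply: (@le_trans _ _ 0); [rewrite pmulr_rle0// ltW|lra].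
have g1 : 0 <= u + Re w - mu * (v + Im w) by rewrite mulrDr; lra.
have g2 : 0 <= v + Im w by lra.
have g3 : u + Re w <= rho by lra.
have g4 := mulr_ge0 (ltW mu0) g2.
split => //=; first by lra.
by rewrite g2 ler_pdivlMr// mulrC; lra.
Qed.

End PhragmenLindelof.

Section HalfPlane.
Variable R : realType.
Local Notation C := R[i].

(** The constant L is removed with the harmonic polynomial
    (x^2 - y^2 + 2 rho y) / rho^2: on the rectangle |x| <= rho, 0 <= y <= rho it is at
    least 0 on the base and at least 1 on the other three sides, and at a fixed
    point it tends to 0 as rho grows. *)
Lemma strip_bound (h : C -> C) (L s : R) : 0 <= L -> holo h ->
  (forall x : R, normc (h x%:C) <= 1) ->
  (forall x y, 0 <= y -> normc (h (x +i* y)) <= expR (L + s * y)) ->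
  forall x y, 0 <= y -> normc (h (x +i* y)) <= expR (s * y).
Proof.
move=> L0 hh hR hg x y y0; apply: ler_expR_limit => // d d0.
pose rho := Num.max (Num.max `|x| y) (L * (x ^+ 2 + 2 * y) / d) + 1.
have xrho : `|x| < rho by rewrite ltr_pwDr// !le_max lexx.
have yrho : y < rho by rewrite ltr_pwDr// !le_max lexx orbT.
have drho : L * (x ^+ 2 + 2 * y) / d <= rho by rewrite ler_wpDr// !le_max lexx orbT.
have rho0 : 0 < rho by exact: le_lt_trans yrho.
have rho1 : 1 <= rho by rewrite lerDr !le_max normr_ge0.
pose q (x y : R) := L / rho ^+ 2 * (x ^+ 2 - y ^+ 2 + 2 * rho * y).
have r2 : 0 < rho ^+ 2 by rewrite exprn_gt0.
have Lr : L / rho ^+ 2 * rho ^+ 2 = L by rewrite divfK// lt0r_neq0.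
have Lr0 : 0 <= L / rho ^+ 2 by rewrite divr_ge0// ltW.
exists (q x y).
  move: drho; rewrite ler_pdivrMr// => drho.
  rewrite /q mulrAC ler_pdivrMr//.
  have : x ^+ 2 - y ^+ 2 + 2 * rho * y <= rho * (x ^+ 2 + 2 * y).
    have := sqr_ge0 y; have : x ^+ 2 <= rho * x ^+ 2 by rewrite ler_peMl// sqr_ge0.
    lra.
  move=> /(ler_wpM2l L0)/le_trans; apply.
  have := ler_wpM2l (ltW rho0) drho; rewrite (expr2 rho); lra.
pose p (z : C) : C := (0 -i* s) * z + ((L / rho ^+ 2)%:C * (z * z) + (0 -i* (L / rho ^+ 2 * (2 * rho))) * z).
have hp : holo p.
  apply: holoD; first by apply: holoM; [exact: holo_cst|exact: holo_id].
  apply: holoD; apply: holoM; do ?[exact: holo_cst|exact: holo_id].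
  by apply: holoM; exact: holo_id.
have pE u v : Re (p (u +i* v)) = s * v + q u v.
  by rewrite /p /q /=; ring.
move: p hp pE => p hp pE.
have cg : continuous (fun p : R * R => 0 : R) by move=> ?; exact: cvg_cst.
have cO := @compact_rectangle R (- rho) rho 0 rho _ cg.
rewrite -pE; apply: (maximum_principle_exp hh hp cO _ (q := (x, y))); last first.
  by rewrite /= y0 -ler_norml (ltW xrho) (ltW yrho).
move=> [u v] [/=]; rewrite -ler_norml => ur /andP[v0 vr] _.
rewrite pE.
have u2 : u ^+ 2 <= rho ^+ 2.
  by rewrite -real_normK ?num_real// ler_pXn2r ?nnegrE// ltW.
have [v1|v1] := leP v 0.
  left; have -> : v = 0 by lra.
  apply: (le_trans (hR u)); rewrite -expR0 ler_expR.
  have -> : q u 0 = L / rho ^+ 2 * u ^+ 2 by rewrite /q; ring.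
  by rewrite mulr0 add0r mulr_ge0// sqr_ge0.
have hb2 := hg u v v0.
have big : rho ^+ 2 <= u ^+ 2 - v ^+ 2 + 2 * rho * v -> normc (h (u +i* v)) <= expR (s * v + q u v).
  move=> /(ler_wpM2l Lr0); rewrite Lr => big.
  by apply: (le_trans hb2); rewrite ler_expR addrC lerD2l.
have [u3|u3] := leP rho `|u|.
  left; apply: big.
  have -> : u ^+ 2 = rho ^+ 2 by rewrite -real_normK ?num_real//; congr (_ ^+ 2); apply/le_anti; rewrite ur.
  have : v * v <= rho * v by rewrite ler_pM2r.
  have : 0 <= rho * v by rewrite mulr_ge0// ltW.
  rewrite (expr2 v); lra.
have [v3|v3] := leP rho v.
  left; apply: big; have -> : v = rho by lra.
  have := sqr_ge0 u; rewrite (expr2 rho); lra.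
right; exists (Num.min v (Num.min (rho - v) (rho - `|u|))).
  by rewrite !lt_min !subr_gt0 v1 v3.
move=> w; rewrite !le_min => /andP[w1 /andP[w2 w3]].
have R3 := le_trans (Re_le_normc w) w3.
have := le_trans (Im_le_normc w) w1; have := le_trans (Im_le_normc w) w2.
rewrite !ler_norml => /andP[a1 a2] /andP[a3 a4].
split => //=.
  by rewrite -ler_norml (le_trans (ler_normD _ _))//; lra.
by apply/andP; split; lra.
Qed.

(** Near the imaginary axis |z| <= (1 + mu) y gives the bound up to the constant L
    at once; the two sectors along the real axis, exchanged by the reflection
    x -> -x, are covered by [sector_bound].  Then [strip_bound] removes L, and mu
    tends to 0. *)
Lemma phragmen_lindelof (h : C -> C) (L s : R) : 0 <= L -> 0 < s -> holo h ->
  (forall x : R, normc (h x%:C) <= 1) ->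
  (forall z, normc (h z) <= expR (L + s * normc z)) ->
  forall x y, 0 <= y -> normc (h (x +i* y)) <= expR (s * y).
Proof.
move=> L0 s0 hh hR hg x y y0; apply: ler_expR_limit => // d d0.
pose mu := Num.min 1 (d / (s * y + 1)).
have sy : 0 <= s * y by rewrite mulr_ge0// ltW.
have sy1 : 0 < s * y + 1 by lra.
have mu0 : 0 < mu by rewrite lt_min ltr01 divr_gt0.
have mu1 : mu <= 1 by rewrite ge_min lexx.
have mud : mu <= d / (s * y + 1) by rewrite ge_min lexx orbT.
exists (mu * (s * y)).
  move: mud; rewrite ler_pdivlMr//; lra.
have -> : s * y + mu * (s * y) = s * (1 + mu) * y by ring.
have mu01 : 0 < mu <= 1 by rewrite mu0.
move: mu mu0 mu1 mu01 {mud} => mu mu0 mu1 mu01.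
apply: (@strip_bound h L) => // {sy sy1 d d0 x y y0} x y y0.
have [xy|xy] := leP (mu * y) x; first exact: sector_bound.
have [xy'|xy'] := leP (mu * y) (- x).
  pose h' (z : C) := conjc (h (conjc (- 1 * z))).
  have hh' : holo h'.
    apply: (@holo_comp R (fun z => - 1 * z) (fun z => conjc (h (conjc z)))).
      by apply: holoM; [exact: holo_cst|exact: holo_id].
    exact: holo_reflect.
  have E u v : h' (u +i* v) = conjc (h ((- u) +i* v)).
    by rewrite /h'; congr (conjc (h _)); rewrite /=; apply/eqP; rewrite eq_complex /=; apply/andP; split; apply/eqP; ring.
  have := @sector_bound R h' L s L0 s0 _ _ mu (- x) y hh' mu01 y0 xy'.
  rewrite E normc_conj opprK; apply.
    by move=> u; rewrite E normc_conj; exact: hR.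
  move=> [u v]; rewrite E normc_conj; apply: (le_trans (hg _)).
  by rewrite /= sqrrN.
apply: (le_trans (hg _)); rewrite ler_expR lerD2l -mulrA ler_pM2l//.
apply: (le_trans (normc_le_ReIm _)); rewrite /= (ger0_norm y0) mulrDl mul1r addrC lerD2l.
by rewrite ler_norml; apply/andP; split; lra.
Qed.

End HalfPlane.

(** * The Bernstein-Szego inequality *)

Section BernsteinSzego.
Variable R : realType.
Local Notation C := R[i].

(** The Chebyshev polynomial of degree 2, which maps cos u to cos (2 u). *)
Definition cheb2 (z : C) : C := 2 * (z * z) - 1.

Lemma normc2 : normc (2 : C) = 2 :> R.
Proof. by rewrite -[2]/(2%:R) -(rmorph_nat (real_complex R)) normc_real ger0_norm. Qed.

Lemma normc_cheb2 z : normc (cheb2 z) <= 2 * normc z ^+ 2 + 1.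
Proof.
apply: (le_trans (le_normcD _ _)).
by rewrite normcN (@normc1 R) lerD2r !normcM normc2 expr2.
Qed.

Lemma cheb2_real (a : R) : cheb2 a%:C = (2 * a ^+ 2 - 1)%:C.
Proof. by rewrite /cheb2 rmorphB rmorphM rmorphXn rmorph1 rmorph_nat expr2. Qed.

(** Composition with [cheb2] preserves the class of functions that are real and at
    most 1 in modulus on the real axis, and doubles the type, so the
    Phragmen-Lindelof bound applies to all the iterates. *)
Lemma iter_cheb2_bound k (h : C -> C) (L s : R) : 0 <= L -> 0 < s -> holo h ->
  (forall x : R, Im (h x%:C) = 0) -> (forall x : R, normc (h x%:C) <= 1) ->
  (forall z, normc (h z) <= expR (L + s * normc z)) ->
  forall x y, 0 <= y -> normc (iter k cheb2 (h (x +i* y))) <= expR (2 ^+ k * (s * y)).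
Proof.
elim: k h L s => [|k IH] h L s L0 s0 hh hI hR hg x y y0.
  by rewrite expr0 mul1r; exact: (phragmen_lindelof L0 s0 hh hR hg).
have hr t : h t%:C = (Re (h t%:C))%:C by have := hI t; case: (h _) => a b /= ->.
rewrite iterSr (_ : 2 ^+ k.+1 * (s * y) = 2 ^+ k * (2 * s * y)); last first.
  by rewrite exprSr; ring.
refine (IH (fun z => cheb2 (h z)) (ln 3 + 2 * L) (2 * s) _ _ _ _ _ _ x y y0).
- by rewrite addr_ge0 ?mulr_ge0// ln_ge0// ler1n.
- by rewrite mulr_gt0.
- apply: holoD; last exact: holo_cst.
  by apply: holoM; [exact: holo_cst|exact: holoM].
- by move=> t; rewrite (hr t) cheb2_real.
- move=> t; have := hR t; rewrite (hr t) cheb2_real !normc_real => a1.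
  have : Re (h t%:C) ^+ 2 <= 1 by rewrite -real_normK ?num_real// expr_le1.
  have := sqr_ge0 (Re (h t%:C)); move: (_ ^+ 2) => a2; clear => ? ?.
  by rewrite ler_norml; apply/andP; split; lra.
- move=> z; apply: (le_trans (normc_cheb2 _)).
  have e1 : 1 <= expR (2 * L + 2 * s * normc z).
    by rewrite -expR0 ler_expR addr_ge0 ?mulr_ge0 ?normc_ge0// ltW.
  have : normc (h z) ^+ 2 <= expR (2 * L + 2 * s * normc z).
    have -> : 2 * L + 2 * s * normc z = 2%:R * (L + s * normc z) by ring.
    by rewrite expRM_natl ler_pXn2r ?nnegrE ?normc_ge0 ?expR_ge0.
  rewrite -addrA (expRD (ln 3)) lnK ?posrE//; clear -e1; lra.
Qed.

Lemma halfC (a b : R) : (a +i* b) / 2 = (a / 2) +i* (b / 2).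
Proof.
rewrite (_ : 2^-1 = (2^-1)%:C); last by rewrite fmorphV rmorph_nat.
by apply/eqP; rewrite eq_complex /= !mulr0 subr0 add0r !eqxx.
Qed.

Lemma joukowski_exists (z : C) : exists w : C,
  [/\ w != 0, 1 <= normc w & z = (w + w^-1) / 2].
Proof.
pose d := sqrtc (z * z - 1).
have d2 : d * d = z * z - 1 by rewrite -expr2 sqr_sqrtc.
have E : (z + d) * (z - d) = 1.
  have -> : (z + d) * (z - d) = z * z - d * d by ring.
  by rewrite d2; ring.
have key (a b : C) : a * b = 1 -> a + b = 2 * z -> 1 <= normc a ->
    exists w : C, [/\ w != 0, 1 <= normc w & z = (w + w^-1) / 2].
  move=> ab apb a1; have a0 : a != 0 by rewrite -normc_gt0 (lt_le_trans _ a1).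
  exists a; split => //; have -> : a^-1 = b by rewrite -[b](mulKf a0) ab mulr1.
  by rewrite apb (mulrC 2) mulfK// pnatr_eq0.
have [n1|n1] := leP 1 (normc (z + d)).
  by apply: (key _ _ E) => //; ring.
apply: (key (z - d) (z + d)); [by rewrite mulrC|by ring|].
have : normc (z + d) * normc (z - d) = 1 by rewrite -normcM E; exact: normc1.
have := normc_ge0 (z - d); move: n1; move: (normc (z + d)) (normc (z - d)) => a b; nra.
Qed.

Lemma iter_cheb2_joukowski k (w : C) : w != 0 ->
  iter k cheb2 ((w + w^-1) / 2) = (w ^+ (2 ^ k) + w^-1 ^+ (2 ^ k)) / 2.
Proof.
move=> w0; elim: k => [|k IH]; first by rewrite expn0 !expr1.
rewrite iterS IH /cheb2 expnS mulnC !exprM.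
have : w ^+ (2 ^ k) * w^-1 ^+ (2 ^ k) = 1 by rewrite -exprMn mulfV// expr1n.
move: (w ^+ _) (w^-1 ^+ _) => a b ab.
rewrite !expr2.
have -> : a * a + b * b = (a + b) * (a + b) - 2 * (a * b) by ring.
by rewrite ab; field.
Qed.

Lemma exp2_bounded_le1 (r c : R) : (forall k, r ^+ (2 ^ k) <= c) -> r <= 1.
Proof.
move=> H; rewrite leNgt; apply/negP => r1.
have B n : 1 + n%:R * (r - 1) <= r ^+ n.
  elim: n => [|n IH]; first by rewrite mul0r addr0 expr0.
  rewrite exprSr -natr1; have rn : 1 <= r ^+ n by rewrite exprn_ege1// ltW.
  have n0 : 0 <= n%:R :> R by [].
  nra.
have d0 : 0 < r - 1 by rewrite subr_gt0.
pose n := Num.truncn (c / (r - 1)).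
have : c < n.+1%:R * (r - 1) by rewrite -ltr_pdivrMr// truncnS_gt.
have nn : n.+1%:R <= (2 ^ n.+1)%:R :> R by rewrite ler_nat ltnW// ltn_expl.
have := H n.+1; have := B (2 ^ n.+1)%N.
move: nn; move: (2 ^ n.+1)%:R n.+1%:R (r ^+ _) => a b e; nra.
Qed.

(** Write z = (w + 1/w) / 2 with |w| >= 1.  The iterates of z grow like |w|^(2^k), so
    the hypothesis forces |w| <= exp t; and z lies on the ellipse with foci -1
    and 1 and semi-axes (|w| + 1/|w|) / 2 and (|w| - 1/|w|) / 2.  The conclusion
    says that z lies inside the ellipse for |w| = exp t, as S = sinh(t)^2 and
    1 + S = cosh(t)^2. *)
Lemma ellipse_bound (z : C) (t S : R) : 0 <= t ->
  S = ((expR t - expR (- t)) / 2) ^+ 2 ->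
  (forall k, normc (iter k cheb2 z) <= expR (2 ^+ k * t)) ->
  Re z ^+ 2 * S + Im z ^+ 2 * (1 + S) <= S * (1 + S).
Proof.
move=> t0 SE H; have [w [w0 w1 zE]] := joukowski_exists z.
have n0 : 0 < normc w by rewrite normc_gt0.
have et0 : expR t != 0 by rewrite gt_eqF ?expR_gt0.
have wt : normc w <= expR t.
  rewrite -[leLHS](divfK et0) ger_pMl ?expR_gt0//.
  apply: (@exp2_bounded_le1 _ 3) => k.
  rewrite exprMn exprVn ler_pdivrMr ?exprn_gt0 ?expR_gt0//.
  have E1 : expR t ^+ (2 ^ k) = expR (2 ^+ k * t) by rewrite -expRM_natl natrX.
  have e1 : 1 <= expR (2 ^+ k * t) by rewrite -expR0 ler_expR mulr_ge0// exprn_ge0.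
  have := H k; rewrite zE iter_cheb2_joukowski// normcM normcV normc2 ler_pdivrMr// E1 => H1.
  have : normc (w ^+ (2 ^ k)) <= normc (w ^+ (2 ^ k) + w^-1 ^+ (2 ^ k)) + normc (w^-1 ^+ (2 ^ k)).
    by rewrite -{1}(addrK (w^-1 ^+ (2 ^ k)) (w ^+ (2 ^ k))) (le_trans (le_normcD _ _))// normcN.
  have : normc (w^-1 ^+ (2 ^ k)) <= 1.
    by rewrite normcX normcV exprVn invf_le1 ?exprn_gt0// exprn_ege1.
  rewrite normcX; clear -H1 e1; lra.
pose r := normc w; pose b := ((r - r^-1) / 2) ^+ 2.
have r0 : 0 < r by [].
have rr : r * r^-1 = 1 by rewrite divff// gt_eqF.
have r2 := normc_sqr w; rewrite -/r in r2.
have bS : b <= S.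
  rewrite /b SE expRN ler_pXn2r ?nnegrE ?divr_ge0// ?subr_ge0.
  - rewrite ler_pM2r// lerB// lef_pV2 ?posrE ?expR_gt0//.
  - by rewrite (le_trans _ w1)// invf_le1.
  - apply: (@le_trans _ _ 1); first by rewrite invf_le1 ?expR_gt0// -expR0 ler_expR.
    by rewrite -expR0 ler_expR.
have b0 : 0 <= b by exact: sqr_ge0.
have wV : w^-1 = (Re w * (r^-1) ^+ 2) -i* (Im w * (r^-1) ^+ 2).
  by rewrite exprVn r2; case: (w) => x y.
pose c := Re w * r^-1; pose d := Im w * r^-1.
have cd : c ^+ 2 + d ^+ 2 = 1.
  by rewrite /c /d !exprMn -mulrDl -r2 -exprMn rr expr1n.
have zw : z = ((Re w + Re w * r^-1 ^+ 2) / 2) +i* ((Im w - Im w * r^-1 ^+ 2) / 2).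
  by rewrite zE wV; move: (r^-1 ^+ 2) => k; rewrite -halfC; case: (w).
have u1 u : u * r^-1 * r = u by rewrite -mulrA (mulrC r^-1) rr mulr1.
have B1 : 1 + b = ((r + r^-1) / 2) ^+ 2 by rewrite /b -{1}rr; move: (r^-1) => v; field.
have X2 : Re z ^+ 2 = c ^+ 2 * (1 + b).
  have -> : Re z = c * ((r + r^-1) / 2).
    rewrite zw /= [RHS]mulrA (mulrDr c) /c u1; congr (_ / _).
    by rewrite expr2 mulrA.
  by rewrite exprMn B1.
have Y2 : Im z ^+ 2 = d ^+ 2 * b.
  have -> : Im z = d * ((r - r^-1) / 2).
    rewrite zw /= [RHS]mulrA (mulrBr d) /d u1; congr (_ / _).
    by rewrite expr2 mulrA.
  by rewrite exprMn.
rewrite X2 Y2.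
have c0 := sqr_ge0 c; have d0 := sqr_ge0 d; have S0 : 0 <= S by rewrite SE; exact: sqr_ge0.
move: cd c0 d0; move: (c ^+ 2) (d ^+ 2) => c' d' cd c0 d0.
have -> : S * (1 + S) = c' * (1 + S) * S + d' * S * (1 + S) by rewrite -[S * (1 + S)]mul1r -cd; ring.
apply: lerD.
  by apply: ler_wpM2r => //; apply: ler_wpM2l => //; rewrite lerD2l.
by apply: ler_wpM2r; [rewrite addr_ge0|exact: ler_wpM2l].
Qed.


Lemma sinh_bound (t : R) : 0 <= t <= 1/2 ->
  0 <= (expR t - expR (- t)) / 2 <= t * (1 + t).
Proof.
move=> /andP[t0 t1]; have H : `|t| <= 1/2 by rewrite ger0_norm.
have := expR_taylor1_bound H; rewrite ler_norml expr2 => /andP[_ H1].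
have H2 := expR_ge1Dx (- t).
have H3 : expR (- t) <= expR t by rewrite ler_expR; lra.
by apply/andP; split; lra.
Qed.

(** At x + iy the function h has real part h(x) + O(y) and imaginary part
    h'(x) y + o(y), while sinh(s y) = s y + o(y); letting y tend to 0 in
    [ellipse_bound] gives the claim. *)
Lemma bernstein_szego_unit (h : C -> C) (L s x : R) (l : C) :
  0 <= L -> 0 < s -> holo h ->
  (forall x : R, Im (h x%:C) = 0) -> (forall x : R, normc (h x%:C) <= 1) ->
  (forall z, normc (h z) <= expR (L + s * normc z)) ->
  cderiv_at h x%:C l -> Re l ^+ 2 <= s ^+ 2 * (1 - Re (h x%:C) ^+ 2).
Proof.
move=> L0 s0 hh hI hR hg hl; set c := Re (h x%:C); set a := Re l.
have c1 : `|c| <= 1 by apply: (le_trans (Re_le_normc _)).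
have c2 : c ^+ 2 <= 1 by rewrite -real_normK ?num_real// expr_le1.
(* K collects the first-order error terms in e; the numerical constant comes
   from (1 + e)^2 (q + 3 e) <= q + 9 e for 0 <= q <= 1 and e <= 1/4. *)
pose K := 9 * s ^+ 2 + 2 * `|a|.
have s20 : 0 < s ^+ 2 by rewrite exprn_gt0.
have K0 : 0 < K by rewrite ltr_pwDl ?mulr_gt0 ?mulr_ge0.
suff key e : 0 < e -> e <= 1/4 -> a ^+ 2 <= s ^+ 2 * (1 - c ^+ 2) + e * K.
  rewrite leNgt; apply/negP => lt; set g := a ^+ 2 - s ^+ 2 * (1 - c ^+ 2).
  have g0 : 0 < g by rewrite subr_gt0.
  have := key (Num.min (1/4) (g / (2 * K))).
  rewrite lt_min ge_min lexx !divr_gt0 ?mulr_gt0//= => /(_ isT isT).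
  have : Num.min (1 / 4) (g / (2 * K)) * K <= g / 2.
    rewrite -ler_pdivlMr// ge_min; apply/orP; right.
    by rewrite (_ : g / 2 / K = g / (2 * K)) //; field; rewrite lt0r_neq0.
  rewrite /g; lra.
move=> e0 e4; have [d d0 D] := hl _ e0.
(* At height y the real part moves by at most e, and s y <= e. *)
pose y := Num.min d (Num.min (e / (`|Im l| + 1)) (e / s)).
have b0 : 0 < `|Im l| + 1 by rewrite ltr_wpDl.
have y0 : 0 < y by rewrite !lt_min d0 !divr_gt0.
have yd : y <= d by rewrite ge_min lexx.
have yb : (`|Im l| + 1) * y <= e.
  by rewrite mulrC -ler_pdivlMr// !ge_min lexx orbT.
have ys : s * y <= e by rewrite mulrC -ler_pdivlMr// !ge_min lexx !orbT.
have yn : normc (0 +i* y) = y by rewrite normc_imag gtr0_norm.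
have := D (0 +i* y); rewrite yn => /(_ yd).
have -> : x%:C + (0 +i* y) = x +i* y.
  by apply/eqP; rewrite eq_complex /= addr0 add0r !eqxx.
set r := _ - _ => rn.
have zE : h (x +i* y) = r + (h x%:C + l * (0 +i* y)) by rewrite /r; ring.
have XE : Re (h (x +i* y)) = c + (Re r - Im l * y).
  by rewrite zE /c; case: (r) (h x%:C) (l) => [? ?] [? ?] [? ?] /=; ring.
have YE : Im (h (x +i* y)) = a * y + Im r.
  rewrite zE /a; have := hI x.
  by case: (r) (h x%:C) (l) => [? ?] [? ?] [? ?] /= ->; ring.
have r1 := le_trans (Re_le_normc r) rn; have r2 := le_trans (Im_le_normc r) rn.
have X1 : `|Re r - Im l * y| <= e.
  apply: (le_trans (ler_normB _ _)); rewrite normrM (gtr0_norm y0).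
  have : e * y <= 1 * y by rewrite ler_pM2r//; lra.
  by move: r1 yb; clear; lra.
have sy0 : 0 <= s * y by rewrite mulr_ge0// ltW.
have := @ellipse_bound (h (x +i* y)) (s * y) _ sy0 erefl
  (fun k => iter_cheb2_bound k L0 s0 hh hI hR hg x (ltW y0)).
have syh : 0 <= s * y <= 1/2 by rewrite sy0; lra.
have := sinh_bound syh; set S0 := (_ - _) / 2 => /andP[S00 S01].
have S02 : S0 ^+ 2 <= s ^+ 2 * (1 + e) ^+ 2 * y ^+ 2.
  have se0 : 0 <= s * (1 + e) * y by apply: mulr_ge0; [apply: mulr_ge0; [exact: ltW|lra]|exact: ltW].
  rewrite -!exprMn ler_pXn2r ?nnegrE//.
  by apply: (le_trans S01); rewrite mulrAC ler_wpM2l// lerD2l.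
have S03 : S0 ^+ 2 <= e.
  have : S0 <= 5/4 * e.
    apply: (le_trans S01); rewrite mulrC ler_pM//; first by rewrite addr_ge0.
    by lra.
  move=> H; apply: (@le_trans _ _ ((5/4 * e) ^+ 2)).
    by rewrite ler_pXn2r ?nnegrE// mulr_ge0// ltW.
  rewrite expr2; have : e * e <= 1/4 * e by rewrite ler_pM2r.
  by clear -e0; lra.
have S04 : 0 <= S0 ^+ 2 by exact: sqr_ge0.
move: (S0 ^+ 2) S02 S03 S04 {S00 S01} => S S02 S03 S04.
rewrite XE YE; set u := Re r - _ in X1 *; set v := Im r in r2 *.
have cu : - e <= c * u.
  have := ler_pM (normr_ge0 c) (normr_ge0 u) c1 X1; rewrite mul1r -normrM ler_norml.
  by case/andP.
have av : - (`|a| * e * y) <= a * v.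
  have := ler_wpM2l (normr_ge0 a) r2; rewrite -normrM ler_norml mulrA.
  by case/andP.
have X2 : c ^+ 2 - 2 * e <= (c + u) ^+ 2.
  by have := sqr_ge0 u; move: cu; clear; rewrite !expr2; lra.
have Y2 : (a ^+ 2 - 2 * `|a| * e) * y ^+ 2 <= (a * y + v) ^+ 2.
  have := sqr_ge0 v; have := ler_wpM2r (ltW y0) av; clear; rewrite !expr2; lra.
move: ((c + u) ^+ 2) ((a * y + v) ^+ 2) X2 Y2 (sqr_ge0 (a * y + v)) => X Y X2 Y2 Y0 E.
have Y3 : Y <= S * (1 + 3 * e - c ^+ 2).
  have h1 := mulr_ge0 Y0 S04.
  have : S * (1 + S - X) <= S * (1 + 3 * e - c ^+ 2).
    by apply: ler_wpM2l => //; move: S03 X2; clear; lra.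
  by move: E h1; clear; lra.
have q0 : 0 <= 1 + 3 * e - c ^+ 2 by move: c2 e0; clear; lra.
have Y4 := le_trans Y3 (ler_wpM2r q0 S02).
have y20 : 0 < y ^+ 2 by rewrite exprn_gt0.
have : a ^+ 2 - 2 * `|a| * e <= s ^+ 2 * ((1 + e) ^+ 2 * (1 + 3 * e - c ^+ 2)).
  rewrite -(ler_pM2r y20); apply: (le_trans Y2); apply: (le_trans Y4).
  by rewrite le_eqVlt; apply/orP; left; apply/eqP; ring.
have : s ^+ 2 * ((1 + e) ^+ 2 * (1 + 3 * e - c ^+ 2)) <= s ^+ 2 * (1 - c ^+ 2 + 9 * e).
  rewrite ler_pM2l//; move: (sqr_ge0 c) c2; move: (c ^+ 2) => q q1 q2.
  have e2 : e * e <= 1/4 * e by rewrite ler_pM2r.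
  have -> : (1 + e) ^+ 2 * (1 + 3 * e - q) = (1 - q + 3 * e) + (2 * e + e * e) * (1 - q + 3 * e) by ring.
  have : (2 * e + e * e) * (1 - q + 3 * e) <= (9/4 * e) * (7/4).
    have e20 := mulr_ge0 (ltW e0) (ltW e0).
    have f1 : 0 <= 2 * e + e * e by move: e0 e20; clear; lra.
    have f2 : 0 <= 1 - q + 3 * e by move: e0 q2; clear; lra.
    have f3 : 2 * e + e * e <= 9/4 * e by move: e2; clear; lra.
    have f4 : 1 - q + 3 * e <= 7/4 by move: q1 e4; clear; lra.
    exact: ler_pM.
  by move: e0; clear; lra.
rewrite /K; clear; lra.
Qed.

(** Dividing h by A + e, with e > 0 so that the divisor is not 0, reduces to the
    previous case; then e tends to 0. *)
Lemma bernstein_szego (h : C -> C) (A C0 s x : R) (l : C) :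
  0 < C0 -> 0 < s -> holo h ->
  (forall x : R, Im (h x%:C) = 0) -> (forall x : R, normc (h x%:C) <= A) ->
  (forall z, normc (h z) <= C0 * expR (s * normc z)) ->
  cderiv_at h x%:C l -> Re l ^+ 2 + s ^+ 2 * Re (h x%:C) ^+ 2 <= s ^+ 2 * A ^+ 2.
Proof.
move=> C00 s0 hh hI hR hg hl.
have A0 : 0 <= A := le_trans (normc_ge0 _) (hR 0).
have s20 : 0 < s ^+ 2 by rewrite exprn_gt0.
suff key e : 0 < e -> Re l ^+ 2 + s ^+ 2 * Re (h x%:C) ^+ 2 <= s ^+ 2 * (A + e) ^+ 2.
  rewrite -ler_pdivrMl//; set B := (_ + _).
  have B0 : 0 <= (s ^+ 2)^-1 * B by apply: mulr_ge0; rewrite ?invr_ge0 ?(ltW s20)// addr_ge0 ?sqr_ge0// mulr_ge0 ?sqr_ge0.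
  rewrite -[leLHS](sqr_sqrtr B0) ler_pXn2r ?nnegrE ?sqrtr_ge0//.
  apply/ler_addgt0Pr => e e0.
  rewrite -(@ler_pXn2r _ 2) ?nnegrE ?sqrtr_ge0 ?addr_ge0 ?(ltW e0)//.
  by rewrite sqr_sqrtr// ler_pdivrMl//; exact: key.
move=> e0; have Ae : 0 < A + e by rewrite ltr_wpDl.
set k : R := (A + e)^-1; have k0 : 0 < k by rewrite invr_gt0.
pose g z := k%:C * h z.
have hg' : holo g by apply: holoM => //; exact: holo_cst.
have nk z : normc (g z) = k * normc (h z) by rewrite normcM normc_real gtr0_norm.
have Rg z : Re (g z) = k * Re (h z) by rewrite /g; case: (h z) => ? ? /=; ring.
have Ig z : Im (g z) = k * Im (h z) by rewrite /g; case: (h z) => ? ? /=; ring.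
have lg : cderiv_at g x%:C (k%:C * l).
  move=> d d0; have [d' d'0 D] := hl _ (mulr_gt0 d0 Ae); exists d' => // w wd.
  rewrite /g (_ : _ - _ - _ = k%:C * (h (x%:C + w) - h x%:C - l * w)); last by ring.
  rewrite normcM normc_real gtr0_norm// /k ler_pdivrMl//.
  by apply: (le_trans (D w wd)); rewrite mulrCA mulrA.
have L0 : 0 <= ln (k * C0 + 1) by rewrite ln_ge0// lerDr mulr_ge0// ltW.
have kC : 0 < k * C0 + 1 by rewrite ltr_wpDl// mulr_ge0// ltW.
have := @bernstein_szego_unit g _ s x _ L0 s0 hg' _ _ _ lg.
rewrite Rg (_ : Re (k%:C * l) = k * Re l); last by case: (l) => ? ? /=; ring.
move=> H; have {H} : (k * Re l) ^+ 2 <= s ^+ 2 * (1 - (k * Re (h x%:C)) ^+ 2).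
  apply: H.
  - by move=> t; rewrite Ig hI mulr0.
  - move=> t; rewrite nk /k ler_pdivrMl// mulr1; apply: (le_trans (hR t)).
    by rewrite lerDl; exact: ltW.
  - move=> z; rewrite nk expRD lnK ?posrE// mulrDl mul1r.
    apply: (@le_trans _ _ (k * C0 * expR (s * normc z))).
      by rewrite -mulrA ler_pM2l.
    by rewrite lerDl expR_ge0.
have kA : k * (A + e) = 1 by rewrite mulVf// gt_eqF.
rewrite -(ler_pM2r (exprn_gt0 2 Ae)).
have -> : (k * Re l) ^+ 2 * (A + e) ^+ 2 = Re l ^+ 2.
  by rewrite -exprMn mulrAC kA mul1r.
have -> : s ^+ 2 * (1 - (k * Re (h x%:C)) ^+ 2) * (A + e) ^+ 2
   = s ^+ 2 * ((A + e) ^+ 2 - (k * (A + e)) ^+ 2 * Re (h x%:C) ^+ 2) by ring.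
rewrite kA expr1n mul1r; clear; lra.
Qed.

End BernsteinSzego.

(** * The Bernstein inequality *)

Section Bernstein.
Variable R : realType.
Local Notation C := R[i].

Lemma halfCD (a : C) : 2^-1%:C * (a + a) = a.
Proof.
by case: a => p q; apply/eqP; rewrite eq_complex /=; apply/andP; split; apply/eqP; field.
Qed.

(** The real part of a rotation of [h], extended holomorphically, turns the
    real case into the bound on the modulus of the derivative. *)
Lemma bernstein (h : C -> C) (A C0 s x : R) (l : C) :
  0 < C0 -> 0 < s -> holo h -> (forall x : R, normc (h x%:C) <= A) ->
  (forall z, normc (h z) <= C0 * expR (s * normc z)) ->
  cderiv_at h x%:C l -> normc l <= s * A.
Proof.
move=> C00 s0 hh hR hg hl.
have A0 : 0 <= A := le_trans (normc_ge0 _) (hR 0).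
have [c c1 cl] := phaseP l.
pose g z := 2^-1%:C * (c * h z + conjc (c * h (conjc z))).
have n2 : normc (2^-1%:C : C) = 2^-1 by rewrite normc_real ger0_norm.
have hch : holo (fun z => c * h z) by apply: holoM => //; exact: holo_cst.
have hg' : holo g.
  by apply: holoM; [exact: holo_cst|apply: holoD => //; exact: (holo_reflect hch)].
have Rg (t : R) : g t%:C = (Re (c * h t%:C))%:C.
  rewrite /g conjc_real; case: (c * _) => p q.
  by apply/eqP; rewrite eq_complex /=; apply/andP; split; apply/eqP; field.
have lg : cderiv_at g x%:C (normc l)%:C.
  move=> e e0; have [d d0 D] := hl e e0; exists d => // w wd.
  have E : (normc l)%:C * w = 2^-1%:C * (c * l * w + conjc (c * l * conjc w)).
    have -> : conjc (c * l * conjc w) = (normc l)%:C * w.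
      by rewrite cl rmorphM; congr (_ * _); [exact: conjc_real|exact: conjcK].
    by rewrite cl halfCD.
  have -> : g (x%:C + w) - g x%:C - (normc l)%:C * w = 2^-1%:C *
     (c * (h (x%:C + w) - h x%:C - l * w) + conjc (c * (h (x%:C + conjc w) - h x%:C - l * conjc w))).
    have cj a b d' : conjc (c * (a - b - d')) = conjc (c * a) - conjc (c * b) - conjc (c * d').
      by rewrite !mulrBr !rmorphB.
    have cx : conjc (x%:C + w) = x%:C + conjc w.
      by rewrite rmorphD; congr (_ + _); exact: conjc_real.
    by rewrite E /g cj cx conjc_real (mulrA c l); ring.
  rewrite normcM n2 mulrC ler_pdivrMr//; apply: (le_trans (le_normcD _ _)).
  rewrite normc_conj !normcM c1 !mul1r mulr2n mulrDr mulr1; apply: lerD; first exact: D.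
  by rewrite -(normc_conj w); apply: D; rewrite normc_conj.
have := @bernstein_szego R g A C0 s x _ C00 s0 hg' _ _ _ lg.
rewrite -[Re (normc l)%:C]/(normc l) => H.
rewrite -(@ler_pXn2r _ 2) ?nnegrE ?normc_ge0 ?mulr_ge0 ?(ltW s0)// exprMn.
apply: le_trans (H _ _ _); first by rewrite lerDl mulr_ge0 ?sqr_ge0.
- by move=> t; rewrite Rg.
- move=> t; rewrite Rg normc_real; apply: (le_trans (Re_le_normc _)).
  by rewrite normcM c1 mul1r.
move=> z; rewrite /g normcM n2 mulrC ler_pdivrMr//; apply: (le_trans (le_normcD _ _)).
rewrite normc_conj !normcM c1 !mul1r mulr2n mulrDr mulr1; apply: lerD => //.
by rewrite -(normc_conj z).
Qed.

End Bernstein.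

(** * Restriction to lines, and the gradient *)

Section EntireDifferential.
Variables (C : numFieldType) (m : nat).
Implicit Types (F : 'rV[C]_m -> C) (z v : 'rV[C]_m).

Lemma entire_along_line F z v : entire F ->
  forall w : C^o, differentiable (fun w : C^o => F (z + w *: v) : C^o) w.
Proof.
move=> eF w.
apply: (@differentiable_comp _ C^o 'rV[C]_m C^o (fun w : C^o => z + w *: v) F).
  apply: differentiableD; first exact: differentiable_cst.
  exact: ex_diff.
exact: eF.
Qed.

Definition entire_diff F z v : C := 'd (F : 'rV[C]_m -> C^o) z v.

Lemma entire_diff_cvg F z v : entire F ->
  (fun w : C => w^-1 * (F (w *: v + z) - F z)) @ (0:C)^' --> (entire_diff F z v : C^o).
Proof.
move=> eF; rewrite /entire_diff -deriveE; last exact: eF.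
by have := @diff_derivable _ _ C^o F z v (eF z).
Qed.

Lemma entire_diff_sum F z (k : 'rV[C]_m) : entire F ->
  \sum_j k 0 j * entire_diff F z (delta_mx 0 j) = entire_diff F z k.
Proof.
move=> eF; rewrite [in RHS](row_sum_delta k) /entire_diff linear_sum /=.
by apply: eq_bigr => j _; rewrite linearZ.
Qed.

End EntireDifferential.

Section DirectionalDerivatives.
Variables (R : realType) (m : nat).
Local Notation C := R[i].

Lemma entire_cderiv (F : 'rV[C]_m -> C) (z v : 'rV[C]_m) : entire F ->
  cderiv_at (fun w => F (z + w *: v)) 0 (entire_diff F z v).
Proof.
move=> eF; pose g w := F (z + w *: v) - F z.
have g0 : g 0 = 0 by rewrite /g scale0r addr0 subrr.
have := entire_diff_cvg (z := z) (v := v) eF.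
rewrite (_ : (fun w => _) = (fun w => w^-1 * g w)); last first.
  by apply/funext => w; rewrite /g (addrC z).
move=> /(cvg_slopeP _ g0) H e /H[d d0 D]; exists d => // w.
by rewrite add0r scale0r addr0; exact: D.
Qed.

Lemma toCD (x y : 'rV[R]_m) : toC (x + y) = toC x + toC y.
Proof. by apply/rowP => j; rewrite !mxE rmorphD. Qed.

Lemma toCZ (k : R) (x : 'rV[R]_m) : toC (k *: x) = k%:C *: toC x.
Proof. by apply/rowP => j; rewrite !mxE rmorphM. Qed.

(** Links the partial derivatives taken separately on real and imaginary parts, as
    in [grad], with complex differentiation: it suffices to let the complex
    increment be real. *)
Lemma real_derive (f : 'rV[R]_m -> C) (k : C -> C) (x v : 'rV[R]_m) (l : C) :
  (forall t : R, f (t *: v + x) = k t%:C) -> cderiv_at k 0 l ->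
  'D_v (fun u => Re (f u)) x +i* 'D_v (fun u => Im (f u)) x = l.
Proof.
move=> fk kl.
have f0 : f x = k 0 by rewrite -[x]add0r -(scale0r v) fk.
suff H (p : C -> R) (pB : forall a b, p (a - b) = p a - p b) (pZ : forall (t : R) a, p (a * t%:C) = p a * t)
    (pn : forall a, `|p a| <= normc a) : 'D_v (fun u => p (f u)) x = p l.
  rewrite (H (@complex.Re R)) ?(H (@complex.Im R)); first by case: (l).
  - by move=> [? ?] [? ?].
  - by move=> ? [? ?] /=; ring.
  - exact: Im_le_normc.
  - by move=> [? ?] [? ?].
  - by move=> ? [? ?] /=; ring.
  - exact: Re_le_normc.
apply: cvg_lim => //; apply/cvgrPdist_le => /= e e0.
have [d d0 D] := kl e e0.
rewrite near_withinE; apply/nbhs_ballP; exists d => //= t.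
rewrite -ball_normE /= sub0r normrN => td t0.
have := D t%:C; rewrite normc_real => /(_ (ltW td)); rewrite add0r => B.
rewrite fk f0 -pB /GRing.scale /=.
rewrite -(ler_pM2r (_ : 0 < `|t|)) ?normr_gt0// -normrM.
apply: le_trans B; rewrite mulrBl distrC; apply: le_trans (pn _).
by rewrite !pB pZ mulrAC mulVf// mul1r.
Qed.

End DirectionalDerivatives.

(** * Symmetric convex bodies and their norms *)

Section Bodies.
Variables (R : realType) (m : nat).
Local Notation C := R[i].
Implicit Types (t x y v : 'rV[R]_m) (z : 'rV[C]_m) (K V : set 'rV[R]_m).

Lemma dotD t x y : dot t (x + y) = dot t x + dot t y.
Proof. by rewrite /dot -big_split; apply: eq_bigr => j _; rewrite mxE mulrDr. Qed.

Lemma dotZ t k x : dot t (k *: x) = k * dot t x.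
Proof. by rewrite /dot mulr_sumr; apply: eq_bigr => j _; rewrite mxE; ring. Qed.

Lemma dot_sym t x : dot t x = dot x t.
Proof. by apply: eq_bigr => j _; rewrite mulrC. Qed.

Lemma dotCD t z w : dotC t (z + w) = dotC t z + dotC t w.
Proof. by rewrite /dotC -big_split; apply: eq_bigr => j _; rewrite mxE mulrDr. Qed.

Lemma dotCZ t k z : dotC t (k *: z) = k * dotC t z.
Proof. by rewrite /dotC mulr_sumr; apply: eq_bigr => j _; rewrite mxE; ring. Qed.

Lemma dotC_toC t x : dotC t (toC x) = (dot t x)%:C.
Proof. by rewrite rmorph_sum; apply: eq_bigr => j _; rewrite mxE rmorphM. Qed.

Lemma dotC_ReIm t z :
  dotC t z = dot t (map_mx (@complex.Re R) z) +i* dot t (map_mx (@complex.Im R) z).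
Proof.
rewrite {1}(_ : z = toC (map_mx (@complex.Re R) z) + 'i *: toC (map_mx (@complex.Im R) z)).

  rewrite dotCD dotCZ !dotC_toC; apply/eqP; rewrite eq_complex /=.
  by apply/andP; split; apply/eqP; ring.
apply/rowP => j; rewrite !mxE; case: (z 0 j) => a b.
by apply/eqP; rewrite eq_complex /=; apply/andP; split; apply/eqP; ring.
Qed.

Lemma normc_dotC t z :
  normc (dotC t z) <= `|dot t (map_mx (@complex.Re R) z)| + `|dot t (map_mx (@complex.Im R) z)|.
Proof. by rewrite dotC_ReIm; exact: normc_le_ReIm. Qed.

Lemma coord_le_norm (x : 'rV[R]_m) j : `|x 0 j| <= `|x|.
Proof.
rewrite [leRHS]mx_normrE.
exact: (le_bigmax_cond _ (fun ij : 'I_1 * 'I_m => `|x ij.1 ij.2|) (j := (0, j))).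
Qed.

Lemma dot_bounded x : exists2 c, 0 <= c & forall t, `|dot t x| <= c * `|t|.
Proof.
exists (\sum_j `|x 0 j|); first exact: sumr_ge0.
move=> t; apply: (le_trans (ler_norm_sum _ _ _)); rewrite mulr_suml; apply: ler_sum => j _.
by rewrite normrM mulrC ler_wpM2l// coord_le_norm.
Qed.

(** Average a ball around an interior point with the opposite of its centre. *)
Lemma body_contains_ball K : convex_body K -> origin_symmetric K ->
  exists2 r : R, 0 < r & forall x, `|x| < r -> K x.
Proof.
move=> [_ cK [y Ky]] sK.
have /nbhs_ballP[r /= r0 Hr] : nbhs y K := Ky.
have Kyy : K y by apply: Hr; exact: ballxx.
exists (r / 2); first by rewrite divr_gt0.
move=> x xr.
have K1 : K (y + 2 *: x).
  apply: Hr; rewrite -ball_normE /= opprD addrA subrr add0r normrN normrZ ger0_norm//; lra.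
have K2 := sK _ Kyy.
have h0 : (0 : R) <= 2^-1 by rewrite invr_ge0.
have h1 : 2^-1 <= 1 :> R by rewrite invf_le1// ler1n.
have H : K (2^-1 *: (y + 2 *: x) + (1 - 2^-1) *: (- y)).
  exact: (set_mem (cK _ _ (Itv01 h0 h1) (mem_set K1) (mem_set K2))).
rewrite (_ : x = 2^-1 *: (y + 2 *: x) + (1 - 2^-1) *: (- y))//.
rewrite (_ : 1 - 2^-1 = 2^-1); last by lra.
by rewrite -scalerDr addrAC subrr add0r scalerA mulVf ?scale1r// pnatr_eq0.
Qed.

(** The polar is bounded because K contains a ball around 0; this makes the suprema
    that define the norms finite. *)
Lemma polar_bounded K : convex_body K -> origin_symmetric K ->
  exists2 c, 0 <= c & forall t x, polar K t -> `|dot t x| <= c * `|x|.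
Proof.
move=> hK sK; have [r r0 Hr] := body_contains_ball hK sK.
exists (2 / r); first by rewrite divr_ge0// ltW.
move=> t x Kt; have [->|x0] := eqVneq x 0.
  by rewrite -(scale0r (0 : 'rV[R]_m)) dotZ mul0r normr0 mulr_ge0 ?divr_ge0// ltW.
have nx : 0 < `|x| by rewrite normr_gt0.
have k0 : 0 < r / 2 / `|x| by rewrite !divr_gt0.
have Kx : K ((r / 2 / `|x|) *: x).
  by apply: Hr; rewrite normrZ (gtr0_norm k0) divfK ?gt_eqF//; lra.
have := Kt _ Kx; rewrite dot_sym dotZ normrM (gtr0_norm k0) -ler_pdivlMl// mulr1.
by rewrite !invfM !invrK; move=> /le_trans; apply; rewrite [2 / r]mulrC.
Qed.

Lemma polar0 K : polar K 0.
Proof. by move=> t _; rewrite -(scale0r (0 : 'rV[R]_m)) dotZ mul0r normr0. Qed.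

Section PolarSup.
Variable K : set 'rV[R]_m.
Hypotheses (hK : convex_body K) (sK : origin_symmetric K).

Lemma dot_le_body_norm t x : polar K t -> `|dot t x| <= body_norm K x.
Proof.
move=> Kt; have [c c0 H] := polar_bounded hK sK.
apply: ub_le_sup; last by exists t.
by exists (c * `|x|) => _ [s Ks <-]; exact: H.
Qed.

Lemma body_norm_le x c : (forall t, polar K t -> `|dot t x| <= c) -> body_norm K x <= c.
Proof.
move=> H; apply: ge_sup; first by exists `|dot 0 x|; exists 0 => //; exact: (@polar0 K).
by move=> _ [t Kt <-]; exact: H.
Qed.

Lemma body_norm_ge0 x : 0 <= body_norm K x.
Proof. by apply: le_trans (dot_le_body_norm x (@polar0 K)); exact: normr_ge0. Qed.

Lemma dotC_le_body_normC t z : polar K t -> normc (dotC t z) <= body_normC K z.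
Proof.
move=> Kt; have [c c0 H] := polar_bounded hK sK.
apply: ub_le_sup; last by exists t.
exists (c * `|map_mx (@complex.Re R) z| + c * `|map_mx (@complex.Im R) z|) => _ [s Ks <-].
by apply: (le_trans (normc_dotC _ _)); apply: lerD; exact: H.
Qed.

Lemma body_normC_le z c : (forall t, polar K t -> normc (dotC t z) <= c) -> body_normC K z <= c.
Proof.
move=> H; apply: ge_sup; first by exists (normc (dotC 0 z)); exists 0 => //; exact: (@polar0 K).
by move=> _ [t Kt <-]; exact: H.
Qed.

Lemma body_normC_scale k x : body_normC K (k *: toC x) = normc k * body_norm K x.
Proof.
have E t : normc (dotC t (k *: toC x)) = normc k * `|dot t x|.
  by rewrite dotCZ dotC_toC normcM normc_real.
apply/eqP; rewrite eq_le; apply/andP; split.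
  apply: body_normC_le => t Kt; rewrite E ler_wpM2l ?normc_ge0//.
  exact: dot_le_body_norm.
have [k0|k0] := eqVneq (normc k) 0.
  by rewrite k0 mul0r; apply: le_trans (dotC_le_body_normC _ (@polar0 K)); exact: normc_ge0.
have kp : 0 < normc k by rewrite lt_neqAle eq_sym k0 normc_ge0.
rewrite -ler_pdivlMl//; apply: body_norm_le => t Kt.
by rewrite ler_pdivlMl// -E; exact: dotC_le_body_normC.
Qed.

Variable V : set 'rV[R]_m.
Hypotheses (hV : convex_body V).

Lemma convex_body_bounded : exists2 N, 0 < N & forall v, V v -> `|v| <= N.
Proof.
have [cV _ _] := hV; have [N [_ HN]] := compact_bounded cV.
exists (`|N| + 1); first by rewrite ltr_wpDl.
by move=> v Vv; apply: HN => //; rewrite ltr_pwDr// ler_norm.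
Qed.

Lemma convex_body_neq0 : exists v, V v.
Proof. by have [_ _ [v /interior_subset]] := hV; exists v. Qed.

Lemma body_norm_le_MKV v : V v -> body_norm K v <= MKV K V.
Proof.
move=> Vv; have [c c0 H] := polar_bounded hK sK; have [N N0 HN] := convex_body_bounded.
apply: ub_le_sup; last by exists v.
exists (c * N) => _ [y Vy <-]; apply: body_norm_le => t Kt.
by apply: (le_trans (H _ _ Kt)); rewrite ler_wpM2l// HN.
Qed.

Lemma MKV_ge0 : 0 <= MKV K V.
Proof.
have [v Vv] := convex_body_neq0.
exact: le_trans (body_norm_ge0 v) (body_norm_le_MKV Vv).
Qed.

Lemma dotC_le_polar_normC v z : V v -> normc (dotC v z) <= polar_normC V z.
Proof.
move=> Vv; have [N N0 HN] := convex_body_bounded.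
have [c c0 Hc] := dot_bounded (map_mx (@complex.Re R) z).
have [d d0 Hd] := dot_bounded (map_mx (@complex.Im R) z).
apply: ub_le_sup; last by exists v.
exists (c * N + d * N) => _ [y Vy <-].
apply: (le_trans (normc_dotC _ _)); apply: lerD.
  by apply: (le_trans (Hc _)); rewrite ler_wpM2l// HN.
by apply: (le_trans (Hd _)); rewrite ler_wpM2l// HN.
Qed.

(** For v in V, |(v, t)| <= ||v||_K <= M(K,V): this is where the constant of the
    theorem comes from. *)
Lemma polar_normC_line t z w : polar K t ->
  polar_normC V (z + w *: toC t) <= polar_normC V z + MKV K V * normc w.
Proof.
move=> Kt; apply: ge_sup.
  by have [v Vv] := convex_body_neq0; exists (normc (dotC v (z + w *: toC t))); exists v.
move=> _ [v Vv <-]; rewrite dotCD dotCZ dotC_toC; apply: (le_trans (le_normcD _ _)).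
apply: lerD; first exact: dotC_le_polar_normC.
rewrite normcM normc_real mulrC ler_wpM2r ?normc_ge0// dot_sym.
exact: le_trans (dot_le_body_norm _ Kt) (body_norm_le_MKV Vv).
Qed.

End PolarSup.
End Bodies.

(** * The inequalities for the gradient *)

Section Inequalities.
Variables (R : realType) (m : nat).
Local Notation C := R[i].
Variables (K V : set 'rV[R]_m).
Hypotheses (hK : convex_body K) (sK : origin_symmetric K) (hV : convex_body V).
Let M := MKV K V.

Lemma le_mul_limit (a b c : R) : 0 <= b -> 0 <= c ->
  (forall e, 0 < e -> a <= ((1 + e) * b + e) * c) -> a <= b * c.
Proof.
move=> b0 c0 H; apply/ler_addgt0Pr => e e0.
have k0 : 0 < (b + 1) * (c + 1) by rewrite mulr_gt0 ?ltr_wpDl.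
set d := e / ((b + 1) * (c + 1)); have d0 : 0 < d by rewrite divr_gt0.
apply: (le_trans (H _ d0)).
have -> : ((1 + d) * b + d) * c = b * c + d * ((b + 1) * c) by ring.
rewrite lerD2l -[leRHS](divfK (lt0r_neq0 k0)) -/d ler_pM2l//.
by rewrite ler_wpM2l ?addr_ge0// lerDl.
Qed.

Lemma le_sup_norm (f : 'rV[R]_m -> C) x : bounded_continuous f -> normc (f x) <= sup_norm f.
Proof.
move=> [_ [b Hb]]; apply: ub_le_sup; last by exists x.
by exists b => _ [y _ <-].
Qed.

Lemma toC_delta j : toC (delta_mx 0 j : 'rV[R]_m) = delta_mx 0 j.
Proof. by apply/rowP => k; rewrite !mxE; case: (_ && _). Qed.

(** The real partial derivatives that define [grad] are values of the complex
    differential of the entire extension, so (t, grad f(x)) is the complex derivative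
    along t. *)
Lemma dotC_grad (f : 'rV[R]_m -> C) (F : 'rV[C]_m -> C) (t x : 'rV[R]_m) :
  entire F -> (forall x, f x = F (toC x)) ->
  dotC t (grad f x) = entire_diff F (toC x) (toC t).
Proof.
move=> eF fF; rewrite -(entire_diff_sum _ _ eF); apply: eq_bigr => j _.
rewrite !mxE; congr (_ * _).
apply: (real_derive (k := fun w => F (toC x + w *: delta_mx 0 j))) => [s|].
  by rewrite fF toCD toCZ toC_delta addrC.
exact: entire_cderiv.
Qed.

(** The summand e makes the rate of growth positive, whatever M(K,V) is. *)
Lemma BV_line_growth (F : 'rV[C]_m -> C) (t : 'rV[R]_m) (z : 'rV[C]_m) (e : R) :
  BV V F -> polar K t -> 0 < e -> exists2 C0, 0 < C0 &
    forall w, normc (F (z + w *: toC t)) <= C0 * expR (((1 + e) * M + e) * normc w).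
Proof.
move=> [_ HF] Kt e0; have [C0 [C00 HC]] := HF e e0.
exists (C0 * expR ((1 + e) * polar_normC V z)); first by rewrite mulr_gt0 ?expR_gt0.
move=> w; apply: (le_trans (HC _)); rewrite -mulrA -expRD ler_pM2l// ler_expR.
have := polar_normC_line hK sK hV z w Kt => /(ler_wpM2l (_ : 0 <= 1 + e)) H.
apply: le_trans (H _) _; first by rewrite addr_ge0// ltW.
rewrite -/M; have := mulr_ge0 (ltW e0) (normc_ge0 w).
move: (polar_normC V z) (normc w) M => p n q; lra.
Qed.

Variables (f : 'rV[R]_m -> C).
Hypothesis (hf : BC V f).
Let A := sup_norm f.

(** The one-variable function to which the inequalities of Bernstein and of
    Bernstein and Szego apply. *)
Lemma BC_line (t x : 'rV[R]_m) : polar K t -> exists h : C -> C,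
  [/\ holo h, forall s : R, h s%:C = f (x + s *: t),
      forall e, 0 < e -> exists2 C0, 0 < C0 &
        forall w, normc (h w) <= C0 * expR (((1 + e) * M + e) * normc w)
    & cderiv_at h 0 (dotC t (grad f x))].
Proof.
move=> Kt; have [[F HF fF] _] := hf; have eF := HF.1.
exists (fun w => F (toC x + w *: toC t)); split.
- exact: entire_along_line.
- by move=> s; rewrite fF toCD toCZ.
- by move=> e e0; exact: BV_line_growth.
- by rewrite (dotC_grad _ _ eF fF); exact: entire_cderiv.
Qed.

Lemma sup_norm_ge0 : 0 <= A.
Proof. exact: le_trans (normc_ge0 _) (le_sup_norm 0 hf.2). Qed.

Lemma rate_gt0 e : 0 < e -> 0 < (1 + e) * M + e.
Proof.
by move=> e0; rewrite ltr_wpDl// mulr_ge0 ?addr_ge0 ?(ltW e0)//; exact: MKV_ge0.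
Qed.

Lemma grad_bound x : body_normC K (grad f x) <= M * A.
Proof.
apply: body_normC_le => // t Kt; have [h [hh hE hg hl]] := BC_line x Kt.
apply: le_mul_limit; [exact: MKV_ge0|exact: sup_norm_ge0|] => e e0.
have [C0 C00 HC] := hg e e0.
apply: (bernstein C00 (rate_gt0 e0) hh _ HC hl) => s.
by rewrite hE; exact: le_sup_norm hf.2.
Qed.

Lemma grad_bound_real x : real_valued f ->
  body_normC K (grad f x) ^+ 2 + M ^+ 2 * Re (f x) ^+ 2 <= M ^+ 2 * A ^+ 2.
Proof.
move=> rf; have M0 := MKV_ge0 hK sK hV; rewrite -/M in M0.
have fA : Re (f x) ^+ 2 <= A ^+ 2.
  rewrite -real_normK ?num_real// ler_pXn2r ?nnegrE ?sup_norm_ge0//.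
  exact: le_trans (Re_le_normc _) (le_sup_norm x hf.2).
set Q := A ^+ 2 - Re (f x) ^+ 2; have Q0 : 0 <= Q by rewrite subr_ge0.
suff H : body_normC K (grad f x) <= M * Num.sqrt Q.
  have : body_normC K (grad f x) ^+ 2 <= (M * Num.sqrt Q) ^+ 2.
    rewrite ler_pXn2r ?nnegrE ?mulr_ge0 ?sqrtr_ge0//.
    by apply: le_trans (dotC_le_body_normC hK sK _ (@polar0 _ _ K)); exact: normc_ge0.
  by rewrite exprMn sqr_sqrtr// /Q mulrBr; lra.
apply: body_normC_le => // t Kt; have [h [hh hE hg hl]] := BC_line x Kt.
apply: le_mul_limit; [by []|exact: sqrtr_ge0|] => e e0.
have [C0 C00 HC] := hg e e0.
have s0 := rate_gt0 e0; set s := _ + e in s0 HC *.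
have I0 : Im (dotC t (grad f x)) = 0.
  rewrite dotC_ReIm /= /dot big1// => j _; rewrite !mxE /=.
  rewrite (_ : (fun u => Im (f u)) = cst 0); last by apply/funext => u; exact: rf.
  by rewrite derive_cst mulr0.
have := @bernstein_szego R h A C0 s 0 _ C00 s0 hh _ _ HC hl.
rewrite hE scale0r addr0 => /(_ _ _) H.
have : Re (dotC t (grad f x)) ^+ 2 <= s ^+ 2 * Q.
  rewrite /Q mulrBr lerBrDr; apply: H => u; rewrite hE; first exact: rf.
  exact: le_sup_norm hf.2.
rewrite -[in s ^+ 2 * Q](sqr_sqrtr Q0) -exprMn => H2.
rewrite -(@ler_pXn2r _ 2) ?nnegrE ?normc_ge0 ?mulr_ge0 ?sqrtr_ge0 ?(ltW s0)//.
by rewrite normc_sqr I0 expr0n addr0.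
Qed.

End Inequalities.

(** * Extremal functions *)

Section EntireComposition.
Variables (C : numFieldType) (m : nat).

Lemma entire_linear_form (k : 'I_m -> C) :
  entire (fun z : 'rV[C]_m => \sum_j k j * z 0 j).
Proof.
move=> z.
rewrite (_ : (fun z : 'rV[C]_m => _) =
    \sum_j (fun z : 'rV[C]_m => k j *: (z 0 j : C^o) : C^o)); last first.
  by apply/funext => y; rewrite fct_sumE.
apply: differentiable_sum => j; apply: differentiableZ; exact: differentiable_coord.
Qed.

Lemma entire_comp (F : 'rV[C]_m -> C) (h : C -> C) : entire F ->
  (forall w : C^o, differentiable (h : C^o -> C^o) w) -> entire (fun z => h (F z)).
Proof. by move=> eF hh z; apply: differentiable_comp; [exact: eF|exact: hh]. Qed.

End EntireComposition.

Section ExtremalFunctions.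
Variable R : realType.
Local Notation C := R[i].
Implicit Types (h : C -> C) (l z : C).

Lemma cderiv_affine h z b c l :
  cderiv_at h (b + c * z) l -> cderiv_at (fun w => h (b + c * w)) z (l * c).
Proof.
move=> H e e0; have c0 : 0 < normc c + 1 by rewrite ltr_wpDl ?normc_ge0.
have [d d0 D] := H _ (divr_gt0 e0 c0); exists (d / (normc c + 1)); first by rewrite divr_gt0.
move=> w; rewrite ler_pdivlMr// => wd.
have cw : normc (c * w) <= normc w * (normc c + 1).
  by rewrite normcM mulrC ler_wpM2l ?normc_ge0// lerDl.
have := D (c * w) (le_trans cw wd).
rewrite (_ : b + c * z + c * w = b + c * (z + w)); last by ring.
rewrite (mulrA l) => /le_trans; apply.
rewrite mulrAC ler_pdivrMr// -mulrA ler_pM2l//.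
Qed.

Lemma cderivD h k z l1 l2 :
  cderiv_at h z l1 -> cderiv_at k z l2 -> cderiv_at (fun w => h w + k w) z (l1 + l2).
Proof.
move=> H1 H2 e e0; have e2 : 0 < e / 2 by rewrite divr_gt0.
have [d d0 D] := H1 _ e2; have [d' d'0 D'] := H2 _ e2.
exists (Num.min d d'); first by rewrite lt_min d0.
move=> w; rewrite le_min => /andP[/D B /D' B'].
have -> : h (z + w) + k (z + w) - (h z + k z) - (l1 + l2) * w =
  (h (z + w) - h z - l1 * w) + (k (z + w) - k z - l2 * w) by ring.
by apply: (le_trans (le_normcD _ _)); lra.
Qed.

Lemma cderivZ h z c l : cderiv_at h z l -> cderiv_at (fun w => c * h w) z (c * l).
Proof.
move=> H e e0; have c0 : 0 < normc c + 1 by rewrite ltr_wpDl ?normc_ge0.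
have [d d0 D] := H _ (divr_gt0 e0 c0); exists d => // w /D B.
have -> : c * h (z + w) - c * h z - c * l * w = c * (h (z + w) - h z - l * w) by ring.
rewrite normcM; apply: (@le_trans _ _ ((normc c + 1) * (e / (normc c + 1) * normc w))).
  by apply: ler_pM; rewrite ?normc_ge0// lerDl.
by rewrite mulrA mulrCA divff ?mulr1// gt_eqF.
Qed.

Lemma normc_expi (s : R) : normc (expi s) = 1.
Proof. by rewrite /expi /= cos2Dsin2 sqrtr1. Qed.

Lemma expiD (s t : R) : expi (s + t) = expi s * expi t.
Proof.
by rewrite /expi sinD cosD; apply/eqP; rewrite eq_complex /= eqxx; apply/eqP; ring.
Qed.

Lemma unit_expi z : normc z = 1 -> exists t : R, z = expi t.
Proof.
move=> z1; have := normc_sqr z; rewrite z1 expr1n => E.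
have : `|Re z| <= 1 by rewrite -z1 Re_le_normc.
rewrite ler_norml => Rz; have cz : cos (acos (Re z)) = Re z by rewrite acosK// in_itv.
have : sin (acos (Re z)) ^+ 2 = Im z ^+ 2 by rewrite sin2cos2 cz E; ring.
move=> /eqP; rewrite eqf_sqr => /orP[] /eqP sz.
  by exists (acos (Re z)); rewrite /expi cz sz; case: (z).
by exists (- acos (Re z)); rewrite /expi cosN sinN cz sz opprK; case: (z).
Qed.

Lemma polar_form z : exists t : R, z = (normc z)%:C * expi t.
Proof.
have [c c1 cz] := phaseP z.
have [t tE] := unit_expi c1; exists (- t).
by rewrite -cz tE mulrAC -expiD subrr /expi cos0 sin0 mul1r.
Qed.

(** The entire extension of c1 exp(is) + c2 exp(-is).  The summands 0 put the
    exponents in the affine form of [cderiv_affine]. *)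
Definition expi_comb (c1 c2 w : C) : C :=
  c1 * cexp (0 + (0 +i* 1) * w) + c2 * cexp (0 + (0 -i* 1) * w).

Lemma holo_expi_comb c1 c2 : holo (expi_comb c1 c2).
Proof.
apply: holoD; apply: holoM; do ?exact: holo_cst.
  apply: (@holo_comp R (fun w => 0 + (0 +i* 1) * w)); last exact: holo_cexp.
  by apply: holoD; [exact: holo_cst|apply: holoM; [exact: holo_cst|exact: holo_id]].
apply: (@holo_comp R (fun w => 0 + (0 -i* 1) * w)); last exact: holo_cexp.
by apply: holoD; [exact: holo_cst|apply: holoM; [exact: holo_cst|exact: holo_id]].
Qed.

Lemma cexp_imag (s : R) : cexp (0 +i* s) = expi s.
Proof. by rewrite /cexp /expi /= expR0 !mul1r. Qed.

Lemma expi_comb_real c1 c2 (s : R) :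
  expi_comb c1 c2 s%:C = c1 * expi s + c2 * expi (- s).
Proof.
rewrite /expi_comb -!cexp_imag; congr (_ * cexp _ + _ * cexp _).
  by apply/eqP; rewrite eq_complex /=; apply/andP; split; apply/eqP; ring.
by apply/eqP; rewrite eq_complex /=; apply/andP; split; apply/eqP; ring.
Qed.

Lemma cderiv_expi_comb c1 c2 (s : R) : cderiv_at (expi_comb c1 c2) s%:C
  ((0 +i* 1) * (c1 * expi s - c2 * expi (- s))).
Proof.
have -> : (0 +i* 1) * (c1 * expi s - c2 * expi (- s)) =
    c1 * (cexp (0 + (0 +i* 1) * s%:C) * (0 +i* 1))
    + c2 * (cexp (0 + (0 -i* 1) * s%:C) * (0 -i* 1)).
  have -> : 0 + (0 +i* 1) * s%:C = 0 +i* s.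
    by apply/eqP; rewrite eq_complex /=; apply/andP; split; apply/eqP; ring.
  have -> : 0 + (0 -i* 1) * s%:C = 0 +i* (- s).
    by apply/eqP; rewrite eq_complex /=; apply/andP; split; apply/eqP; ring.
  rewrite !cexp_imag (_ : 0 -i* 1 = - (0 +i* 1)); first by ring.
  by apply/eqP; rewrite eq_complex /= oppr0 !eqxx.
by apply: cderivD; apply: cderivZ; apply: cderiv_affine; exact: cderiv_cexp.
Qed.

Lemma normc_expi_comb c1 c2 w :
  normc (expi_comb c1 c2 w) <= (normc c1 + normc c2) * expR (normc w).
Proof.
apply: (le_trans (le_normcD _ _)); rewrite !normcM !normc_cexp mulrDl.
have := Im_le_normc w; rewrite ler_norml => /andP[w1 w2].
apply: lerD; apply: ler_wpM2l; rewrite ?normc_ge0// ler_expR.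
  by move: w1; case: (w) => p q /=; move: (Num.sqrt _) => n; lra.
by move: w2; case: (w) => p q /=; move: (Num.sqrt _) => n; lra.
Qed.

Lemma normc_expi_comb_real c1 c2 (s : R) :
  normc (expi_comb c1 c2 s%:C) <= normc c1 + normc c2.
Proof.
by rewrite expi_comb_real (le_trans (le_normcD _ _))// !normcM !normc_expi !mulr1.
Qed.

(** The angle s is chosen so that both terms have the same argument. *)
Lemma normc_expi_comb_max c1 c2 :
  exists s : R, normc (c1 * expi s + c2 * expi (- s)) = normc c1 + normc c2.
Proof.
have [p pE] := polar_form c1; have [q qE] := polar_form c2.
exists ((q - p) / 2); rewrite pE qE -!mulrA -!expiD.
have -> : p + (q - p) / 2 = (p + q) / 2 by lra.
have -> : q - (q - p) / 2 = (p + q) / 2 by lra.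
by rewrite -mulrDl -rmorphD !normcM !normc_expi !normc_real !mulr1 !ger0_norm ?addr_ge0 ?normc_ge0.
Qed.

End ExtremalFunctions.

Section Sharpness.
Variables (R : realType) (m : nat).
Local Notation C := R[i].
Implicit Types (a x : 'rV[R]_m) (K V : set 'rV[R]_m).

Lemma dot_surjective a (s : R) : a != 0 -> exists x, dot a x = s.
Proof.
move=> a0; have aa : dot a a != 0.
  apply: contraNneq a0 => /eqP; rewrite psumr_eq0 => [/allP H|j _]; last by rewrite -expr2 sqr_ge0.
  apply/eqP/rowP => j; rewrite mxE; have := H j (mem_index_enum _).
  by rewrite /= mulf_eq0 orbb => /eqP.
by exists ((s / dot a a) *: a); rewrite dotZ divfK.
Qed.

Lemma boundary_mem V a : compact V -> boundary V a -> V a.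
Proof.
move=> cV [aV _]; have /closure_id -> // : closed V.
by apply: compact_closed => //; exact: norm_hausdorff.
Qed.

Lemma boundary_neq0 V a : convex_body V -> origin_symmetric V -> boundary V a -> a != 0.
Proof.
move=> hV sV [_ na]; apply/eqP => a0; apply: na; rewrite a0.
have [r r0 Hr] := body_contains_ball hV sV.
apply/nbhs_ballP; exists r => // x; rewrite -ball_normE /= sub0r normrN; exact: Hr.
Qed.

Definition expi_wave a (c1 c2 : C) (x : 'rV[R]_m) : C :=
  c1 * expi (dot a x) + c2 * expi (- dot a x).

Lemma expi_waveE a c1 c2 x : expi_wave a c1 c2 x = expi_comb c1 c2 (dot a x)%:C.
Proof. by rewrite expi_comb_real. Qed.

Lemma BV_expi_wave V a c1 c2 : convex_body V -> V a ->
  BV V (fun z => expi_comb c1 c2 (dotC a z)).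
Proof.
move=> hV Va; split.
  apply: entire_comp; first exact: entire_linear_form.
  exact: holo_expi_comb.
move=> e e0; exists (normc c1 + normc c2 + 1); split.
  by rewrite ltr_wpDl// addr_ge0 ?normc_ge0.
move=> z; apply: (le_trans (normc_expi_comb _ _ _)).
have az := dotC_le_polar_normC hV z Va; have az0 := le_trans (normc_ge0 _) az.
apply: ler_pM; rewrite ?addr_ge0 ?normc_ge0 ?expR_ge0 ?lerDl// ler_expR.
by apply: (le_trans az); rewrite mulrDl mul1r lerDl mulr_ge0// ltW.
Qed.

Lemma continuous_dot a : continuous (dot a).
Proof.
move=> x; have F : Filter (nbhs x) := nbhs_filter x.
apply/cvgrPdist_le => e e0; have [c c0 Hc] := dot_bounded a.
have c1 : 0 < c + 1 by rewrite ltr_wpDl.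
apply: filterS (nbhsx_ballx x (e / (c + 1)) (divr_gt0 e0 c1)) => y.
rewrite -ball_normE /= ltr_pdivlMr// => /ltW yx.
have -> : dot a x - dot a y = dot a (x - y) by rewrite dotD -[- y]scaleN1r dotZ mulN1r.
rewrite dot_sym; apply: (le_trans (Hc _)); apply: le_trans yx.
by rewrite mulrC ler_wpM2l// lerDl.
Qed.

Lemma continuous_expi_wave a c1 c2 : continuous (expi_wave a c1 c2 : 'rV[R]_m -> C^o).
Proof.
move=> x.
have -> : (expi_wave a c1 c2 : _ -> C^o) =
    (expi_comb c1 c2 : C^o -> C^o) \o ((fun s : R => s%:C : C^o) \o dot a).
  by apply/funext => y; exact: expi_waveE.
apply: continuous_comp; last by apply: differentiable_continuous; exact: holo_expi_comb.
apply: continuous_comp; first exact: continuous_dot.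
apply/cvgrPdist_le => /= e e0.
have eE : e = (Re e)%:C by rewrite RRe_real // gtr0_real.
move: e0; rewrite eE ltcR => e0; near=> y.
rewrite normr_normc lecR -rmorphB normc_real.
by near: y; exact: cvgr_dist_le.
Unshelve. all: by end_near. Qed.

Lemma BC_expi_wave V a c1 c2 : convex_body V -> V a -> BC V (expi_wave a c1 c2).
Proof.
move=> hV Va; split.
  exists (fun z => expi_comb c1 c2 (dotC a z)); first exact: BV_expi_wave.
  by move=> x; rewrite expi_waveE dotC_toC.
split; first exact: continuous_expi_wave.
by exists (normc c1 + normc c2) => x; rewrite expi_waveE normc_expi_comb_real.
Qed.

Lemma sup_norm_expi_wave a c1 c2 : a != 0 ->
  sup_norm (expi_wave a c1 c2) = normc c1 + normc c2.
Proof.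
move=> a0; have ub : ubound (range (fun x => normc (expi_wave a c1 c2 x))) (normc c1 + normc c2).
  by move=> _ [x _ <-]; rewrite expi_waveE normc_expi_comb_real.
apply/eqP; rewrite eq_le; apply/andP; split.
  by apply: ge_sup => //; exists (normc (expi_wave a c1 c2 0)); exists 0.
have [s sE] := normc_expi_comb_max c1 c2; have [x xs] := dot_surjective s a0.
apply: ub_le_sup; first by exists (normc c1 + normc c2).
by exists x => //; rewrite /expi_wave xs.
Qed.

Lemma dot_delta a j : dot a (delta_mx 0 j) = a 0 j.
Proof.
rewrite /dot (bigD1 j)//= mxE !eqxx mulr1 big1 ?addr0// => k /negPf kj.
by rewrite mxE kj andbF mulr0.
Qed.

Lemma grad_expi_wave a c1 c2 x : grad (expi_wave a c1 c2) x =
  ((0 +i* 1) * (c1 * expi (dot a x) - c2 * expi (- dot a x))) *: toC a.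
Proof.
apply/rowP => j; rewrite !mxE.
apply: (real_derive (k := fun w => expi_comb c1 c2 ((dot a x)%:C + (a 0 j)%:C * w))).
  move=> t; rewrite expi_waveE dotD dotZ dot_delta; congr (expi_comb _ _ _).
  by rewrite rmorphD rmorphM addrC (mulrC t%:C).
by apply: cderiv_affine; rewrite mulr0 addr0; exact: cderiv_expi_comb.
Qed.

Lemma body_normC_grad_expi_wave K a c1 c2 x : convex_body K -> origin_symmetric K ->
  body_normC K (grad (expi_wave a c1 c2) x) =
  normc (c1 * expi (dot a x) - c2 * expi (- dot a x)) * body_norm K a.
Proof.
by move=> hK sK; rewrite grad_expi_wave body_normC_scale// normcM normc_imag normr1 mul1r.
Qed.

Lemma trig_wave a (r1 r2 : R) :
  (fun x => (r1 * cos (dot a x) + r2 * sin (dot a x))%:C) =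
  expi_wave a ((r1 / 2) -i* (r2 / 2)) ((r1 / 2) +i* (r2 / 2)).
Proof.
apply/funext => x; rewrite /expi_wave /expi cosN sinN.
by apply/eqP; rewrite eq_complex /=; apply/andP; split; apply/eqP; field.
Qed.

Lemma normc_trig_coef (r1 r2 : R) :
  normc ((r1 / 2) -i* (r2 / 2)) + normc ((r1 / 2) +i* (r2 / 2)) = Num.sqrt (r1 ^+ 2 + r2 ^+ 2).
Proof.
have E : (r1 / 2) ^+ 2 + (r2 / 2) ^+ 2 = (r1 ^+ 2 + r2 ^+ 2) * 2^-1 ^+ 2 by field.
rewrite /= sqrrN E sqrtrM ?addr_ge0 ?sqr_ge0// sqrtr_sqr ger0_norm//.
by rewrite -splitr.
Qed.

Lemma body_normC_grad_trig_wave K a (r1 r2 : R) : convex_body K -> origin_symmetric K ->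
  body_normC K (grad (fun x => (r1 * cos (dot a x) + r2 * sin (dot a x))%:C) 0)
  = `|r2| * body_norm K a.
Proof.
move=> hK sK; rewrite trig_wave body_normC_grad_expi_wave//; congr (_ * _).
have -> : dot a 0 = 0 by rewrite -(scale0r (0 : 'rV[R]_m)) dotZ mul0r.
rewrite oppr0 /expi cos0 sin0 (_ : _ - _ = 0 +i* (- r2)) ?normc_imag ?normrN//.
by apply/eqP; rewrite eq_complex /=; apply/andP; split; apply/eqP; field.
Qed.

End Sharpness.

Theorem corollary2p4 (R : realType) (m : nat) (hm : (1 <= m)%N)
  (K V : set 'rV[R]_m)
  (hK : convex_body K) (sK : origin_symmetric K)
  (hV : convex_body V) (sV : origin_symmetric V)
  (a : 'rV[R]_m) (ha : boundary V a) (haM : body_norm K a = MKV K V) :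
  (* (a) *)
  [/\ forall f : 'rV[R]_m -> R[i], BC V f -> forall x : 'rV[R]_m,
        body_normC K (grad f x) <= MKV K V * sup_norm f,
      forall C1 C2 : R[i],
        let f0 := fun x : 'rV[R]_m =>
          C1 * expi (dot a x) + C2 * expi (- dot a x) in
        BC V f0 /\
        exists x0 : 'rV[R]_m,
          body_normC K (grad f0 x0) = MKV K V * sup_norm f0
    & (* sharpness: M(K,V) is the least admissible constant *)
      forall c : R,
        (forall f : 'rV[R]_m -> R[i], BC V f -> forall x : 'rV[R]_m,
           body_normC K (grad f x) <= c * sup_norm f) ->
        MKV K V <= c]
  /\
  (* (b) *)
  [/\ forall f : 'rV[R]_m -> R[i], BC V f -> real_valued f ->
        forall x : 'rV[R]_m,
        body_normC K (grad f x) ^+ 2 + MKV K V ^+ 2 * complex.Re (f x) ^+ 2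
          <= MKV K V ^+ 2 * sup_norm f ^+ 2,
      exists x0 : 'rV[R]_m, forall R1 R2 : R,
        let f0 := fun x : 'rV[R]_m =>
          (R1 * cos (dot a x) + R2 * sin (dot a x))%:C in
        [/\ BC V f0, real_valued f0,
            sup_norm f0 = Num.sqrt (R1 ^+ 2 + R2 ^+ 2)
          & body_normC K (grad f0 x0) ^+ 2
              + MKV K V ^+ 2 * complex.Re (f0 x0) ^+ 2
            = MKV K V ^+ 2 * sup_norm f0 ^+ 2],
      (* sharpness: M(K,V) cannot be replaced by a smaller constant, neither on
         both sides nor on the right-hand side alone *)
      forall c : R, 0 <= c ->
        (forall f : 'rV[R]_m -> R[i], BC V f -> real_valued f ->
           forall x : 'rV[R]_m,
           body_normC K (grad f x) ^+ 2 + c ^+ 2 * complex.Re (f x) ^+ 2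
             <= c ^+ 2 * sup_norm f ^+ 2) ->
        MKV K V <= c
    & forall c : R, 0 <= c ->
        (forall f : 'rV[R]_m -> R[i], BC V f -> real_valued f ->
           forall x : 'rV[R]_m,
           body_normC K (grad f x) ^+ 2 + MKV K V ^+ 2 * complex.Re (f x) ^+ 2
             <= c ^+ 2 * sup_norm f ^+ 2) ->
        MKV K V <= c].
Proof.
set M := MKV K V in haM *.
have Va : V a := boundary_mem (let: And3 cV _ _ := hV in cV) ha.
have a0 : a != 0 := boundary_neq0 hV sV ha.
have M0 : 0 <= M := MKV_ge0 hK sK hV.
have dot0 : dot a 0 = 0 by rewrite -(scale0r (0 : 'rV[R]_m)) dotZ mul0r.
have trigBC r1 r2 : BC V (fun x => (r1 * cos (dot a x) + r2 * sin (dot a x))%:C).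
  by rewrite trig_wave; exact: BC_expi_wave.
have trig_sup r1 r2 : sup_norm (fun x => (r1 * cos (dot a x) + r2 * sin (dot a x))%:C)
    = Num.sqrt (r1 ^+ 2 + r2 ^+ 2).
  by rewrite trig_wave sup_norm_expi_wave// normc_trig_coef.
have sup01 : sup_norm (fun x => (0 * cos (dot a x) + 1 * sin (dot a x))%:C) = 1.
  by rewrite trig_sup expr0n add0r expr1n sqrtr1.
have at0 : Re (0 * cos (dot a 0) + 1 * sin (dot a 0))%:C = 0.
  by rewrite /= dot0 sin0 mulr0 mul0r addr0.
split; split.
- by move=> f hf x; exact: grad_bound.
- move=> C1 C2 f0; split; first exact: BC_expi_wave.
  (* The gradient involves C1 e^(is) - C2 e^(-is), so it is largest where the sum
     with - C2 is. *)
  have [s sE] := normc_expi_comb_max C1 (- C2); have [x xs] := dot_surjective s a0.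
  exists x; rewrite [LHS]body_normC_grad_expi_wave// [sup_norm _]sup_norm_expi_wave//.
  by rewrite xs -mulNr sE normcN haM mulrC.
- move=> c /(_ _ (BC_expi_wave 1 0 hV Va) 0).
  rewrite body_normC_grad_expi_wave// sup_norm_expi_wave// haM dot0.
  rewrite mul0r subr0 mul1r normc_expi (@normc0 R) (@normc1 R) addr0 mul1r.
  by rewrite mulr1.
- by move=> f hf rf x; exact: grad_bound_real.
- exists 0 => R1 R2 f0; split; [exact: trigBC|by move=> x|exact: trig_sup|].
  rewrite /f0 body_normC_grad_trig_wave// trig_sup /= dot0 cos0 sin0 mulr1 mulr0 addr0 haM.
  rewrite sqr_sqrtr ?addr_ge0 ?sqr_ge0// exprMn real_normK ?num_real//; ring.
- move=> c c0 /(_ _ (trigBC 0 1) (fun=> erefl) 0).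
  rewrite body_normC_grad_trig_wave// sup01 normr1 mul1r haM at0 expr0n mulr0 addr0.
  by rewrite expr1n mulr1 ler_pXn2r ?nnegrE.
- move=> c c0 /(_ _ (trigBC 0 1) (fun=> erefl) 0).
  rewrite body_normC_grad_trig_wave// sup01 normr1 mul1r haM at0 expr0n mulr0 addr0.
  by rewrite expr1n mulr1 ler_pXn2r ?nnegrE.
Qed.
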